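(* Let $G$ be a Lie group and let the abelian subgroup $\mathfrak g$ of $T^*TG\simeq(G\circledS\mathfrak g_1)\circledS(\mathfrak g_2^*\times\mathfrak g_3^* )$ act on $T^*TG$ by $((h,\eta,\mu,\nu);\xi)\mapsto(h,\eta+\mathrm{Ad}_h\xi,\mu,\nu)$. Poisson reduction of $T^*TG$ by $\mathfrak g$ gives the Poisson manifold $G\circledS(\mathfrak g_2^*\times\mathfrak g_3^* )$, with elements $(g,\mu,\nu)$, endowed with the Poisson bracket $$\{H,K\}(g,\mu,\nu)=\Big\langle T_e^*R_g\frac{\delta H}{\delta g},\frac{\delta K}{\delta\mu}\Big\rangle-\Big\langle T_e^*R_g\frac{\delta K}{\delta g},\frac{\delta H}{\delta\mu}\Big\rangle+\Big\langle\mu,\Big[\frac{\delta H}{\delta\mu},\frac{\delta K}{\delta\mu}\Big]\Big\rangle+\Big\langle\nu,\Big[\frac{\delta H}{\delta\mu},\frac{\delta K}{\delta\nu}\Big]-\Big[\frac{\delta K}{\delta\mu},\frac{\delta H}{\delta\nu}\Big]\Big\rangle$$ for functions $H=H(g,\mu,\nu)$ and $K=K(g,\mu,\nu)$.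
   Context: $G$ is a (finite-dimensional) Lie group with identity $e$, $\mathfrak g=T_eG$, dual $\mathfrak g^*$; $\mathfrak g_i,\mathfrak g_i^*$ denote copies of $\mathfrak g,\mathfrak g^*$. $R_g$ is right multiplication, $T_e^*R_g:T_g^*G\to\mathfrak g^*$ the dual of $T_eR_g$. $\mathrm{Ad}_g=T_e(h\mapsto ghg^{-1})$, $\mathrm{ad}_\xi\eta=[\xi,\eta]=\frac{d}{dt}|_{t=0}\mathrm{Ad}_{\exp t\xi}\eta$, and $\langle\mathrm{ad}^*_\xi\mu,\eta\rangle=-\langle\mu,[\xi,\eta]\rangle$. $TG$ is identified with $G\circledS\mathfrak g$ by $V_g\mapsto(g,T_gR_{g^{-1}}V_g)$, with group law $(g,\xi)(h,\eta)=(gh,\xi+\mathrm{Ad}_g\eta)$. $T^*TG=T^*(G\circledS\mathfrak g)$ is identified with $G\times\mathfrak g_1\times\mathfrak g_2^*\times\mathfrak g_3^*$ by sending a covector $(\alpha_g,\alpha_\xi)$ at $(g,\xi)$ to $(g,\xi,\mu,\nu)=(g,\xi,T_e^*R_g\alpha_g+\mathrm{ad}^*_\xi\alpha_\xi,\alpha_\xi)$; $\Omega_{T^*TG}$ is the canonical symplectic form $d\theta$ ($\theta$ the Liouville form) transported by this map. Hamiltonian vector fields satisfy $i_{X_H}\Omega=-dH$ and $\{H,K\}=dH(X_K)$. The Poisson reduced bracket is the restriction of this bracket to functions invariant under the action (those independent of $\xi\in\mathfrak g_1$). $\frac{\delta H}{\delta g}\in T_g^*G$, $\frac{\delta H}{\delta\mu},\frac{\delta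 H}{\delta\nu}\in\mathfrak g$ are partial derivatives. *)

(* Defs.v *)
From HB Require Import structures.
From mathcomp Require Import all_boot all_order all_algebra.
From mathcomp Require Import all_classical all_reals all_analysis.

Set Implicit Arguments.
Unset Strict Implicit.
Unset Printing Implicit Defensive.

Import Order.TTheory GRing.Theory Num.Theory.
Import numFieldNormedType.Exports.

Local Open Scope classical_set_scope.
Local Open Scope ring_scope.

(* On an open set U, this is the class C^k. *)
Fixpoint Ck_on (R : realType) (V W : normedModType R) (k : nat)
    (U : set V) (f : V -> W) : Prop :=
  match k with
  | 0 => forall x, U x -> {for x, continuous f}
  | k'.+1 => (forall x, U x -> differentiable f x) /\
             (forall v, Ck_on k' U ('D_v f))
  end.

Definition smooth_on (R : realType) (V W : normedModType R)
    (U : set V) (f : V -> W) : Prop := forall k, Ck_on k U f.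

(* An atlas on M with values in R^n.  The maps [crd i] and [par i] are total
   functions; only [crd i] on [dom i] and [par i] on [crd i @` dom i] matter.
   The atlas comes with a preferred chart [chart_at x] around each x, and the
   tangent space T_x M is R^n = 'rV[R]_n, a tangent vector being represented by
   its components in the chart [chart_at x].  The axioms of a smooth manifold
   are in [smooth_manifold]. *)
Record atlas (R : realType) (n : nat) (M : Type) := Atlas {
  chart : Type;
  dom : chart -> set M;
  crd : chart -> M -> 'rV[R]_n;
  par : chart -> 'rV[R]_n -> M;
  chart_at : M -> chart }.

Section Manifolds.
Context {R : realType}.

(* The topology of M is the one induced by the atlas. *)
Definition mopen n (M : Type) (A : atlas R n M) (O : set M) : Prop :=
  forall i : chart A, open (crd i @` (dom i `&` O)).

Definition mhausdorff n (M : Type) (A : atlas R n M) : Prop :=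
  forall x y : M, x <> y -> exists O O' : set M,
    [/\ mopen A O, mopen A O', O x, O' y & O `&` O' = set0].

Definition msecond_countable n (M : Type) (A : atlas R n M) : Prop :=
  exists B : nat -> set M, (forall k, mopen A (B k)) /\
    (forall O x, mopen A O -> O x -> exists2 k, B k x & B k `<=` O).

Definition smooth_manifold n (M : Type) (A : atlas R n M) : Prop :=
  [/\ (forall x, dom (chart_at A x) x),
      (forall (i : chart A) x, dom i x -> par i (crd i x) = x),
      (forall i j : chart A, open (crd i @` (dom i `&` dom j)) /\
         smooth_on (crd i @` (dom i `&` dom j)) (crd j \o par i)),
      mhausdorff A &
      msecond_countable A].

Definition smooth_map m (M : Type) (A : atlas R m M) n (N : Type)
    (B : atlas R n N) (f : M -> N) : Prop :=
  forall (i : chart A) (j : chart B),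
    open (crd i @` (dom i `&` f @^-1` dom j)) /\
    smooth_on (crd i @` (dom i `&` f @^-1` dom j)) (crd j \o f \o par i).

Definition smooth_fun n (M : Type) (A : atlas R n M) (H : M -> R) : Prop :=
  forall i : chart A, smooth_on (crd i @` dom i) (H \o par i).

(* T_x f : T_x M -> T_(f x) N *)
Definition tmap m (M : Type) (A : atlas R m M) n (N : Type) (B : atlas R n N)
    (f : M -> N) (x : M) : 'rV[R]_m -> 'rV[R]_n :=
  'd (crd (chart_at B (f x)) \o f \o par (chart_at A x))
     (crd (chart_at A x) x).

(* The differential at x of a function with values in a normed space. *)
Definition mdiff n (M : Type) (A : atlas R n M) (W : normedModType R)
    (F : M -> W) (x : M) : 'rV[R]_n -> W :=
  'd (F \o par (chart_at A x)) (crd (chart_at A x) x).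

Definition vec_atlas n : atlas R n 'rV[R]_n :=
  @Atlas R n 'rV[R]_n unit (fun _ => setT) (fun _ => id) (fun _ => id)
    (fun _ => tt).

Definition prod_atlas m (M : Type) (A : atlas R m M) n (N : Type)
    (B : atlas R n N) : atlas R (m + n) (M * N) :=
  @Atlas R (m + n) (M * N) (chart A * chart B)
    (fun i => dom i.1 `*` dom i.2)
    (fun i x => row_mx (crd i.1 x.1) (crd i.2 x.2))
    (fun i y => (par i.1 (lsubmx y), par i.2 (rsubmx y)))
    (fun x => (chart_at A x.1, chart_at B x.2)).

(* The dual of 'rV[R]_n is 'rV[R]_n again, through the pairing
   <mu, xi> = \sum_k mu_k xi_k; [dual_repr f] represents the linear form f. *)
Definition pairing n (mu xi : 'rV[R]_n) : R := \sum_k mu ord0 k * xi ord0 k.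

Definition dual_repr n (f : 'rV[R]_n -> R) : 'rV[R]_n :=
  \row_k f (delta_mx ord0 k).

(* T_y (par i) : R^n -> T_(par i y) M *)
Definition tpar n (M : Type) (A : atlas R n M) (i : chart A) (y : 'rV[R]_n) :
    'rV[R]_n -> 'rV[R]_n :=
  'd (crd (chart_at A (par i y)) \o par i) y.

(* T_x (crd i) : T_x M -> R^n, for x in dom i *)
Definition tcrd n (M : Type) (A : atlas R n M) (i : chart A) (x : M) :
    'rV[R]_n -> 'rV[R]_n :=
  'd (crd i \o par (chart_at A x)) (crd (chart_at A x) x).

(* T^*Q, whose points are the pairs (q, alpha) with alpha in T_q^* Q, with the
   charts (q, p) induced by the charts q of Q. *)
Definition cotangent n (Q : Type) (A : atlas R n Q) :
    atlas R (n + n) (Q * 'rV[R]_n) :=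
  @Atlas R (n + n) (Q * 'rV[R]_n) (chart A)
    (fun i z => dom i z.1)
    (fun i z => row_mx (crd i z.1)
       (dual_repr (fun w => pairing z.2 (tpar i (crd i z.1) w))))
    (fun i y => (par i (lsubmx y),
       dual_repr (fun v => pairing (rsubmx y) (tcrd i (par i (lsubmx y)) v))))
    (fun z => chart_at A z.1).

Definition liouville n (Q : Type) (A : atlas R n Q) (z : Q * 'rV[R]_n)
    (v : 'rV[R]_(n + n)) : R :=
  pairing z.2 (tmap (cotangent A) A fst z v).

(* The exterior derivative of a 1-form theta, computed in the chart
   [chart_at x] by d theta(v, w) = D_v (theta(w)) - D_w (theta(v)) for the
   constant vector fields v and w of that chart. *)
Definition ext_d n (M : Type) (A : atlas R n M) (theta : M -> 'rV[R]_n -> R)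
    (x : M) (v w : 'rV[R]_n) : R :=
  let i := chart_at A x in
  let theta_i y u := theta (par i y) (tpar i y u) in
  'D_v (theta_i ^~ w) (crd i x) - 'D_w (theta_i ^~ v) (crd i x).

Definition pullback2 m (M : Type) (A : atlas R m M) n (N : Type)
    (B : atlas R n N) (f : M -> N) (Om : N -> 'rV[R]_n -> 'rV[R]_n -> R)
    (x : M) (v w : 'rV[R]_m) : R :=
  Om (f x) (tmap A B f x v) (tmap A B f x w).

Definition hamiltonian_vf n (M : Type) (A : atlas R n M)
    (Om : M -> 'rV[R]_n -> 'rV[R]_n -> R) (H : M -> R) (X : M -> 'rV[R]_n) :
    Prop :=
  forall x w, Om x (X x) w = - mdiff A H x w.

(* {H, K} = dH (X_K), for a choice of X_K *)
Definition symplectic_bracket n (M : Type) (A : atlas R n M)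
    (Om : M -> 'rV[R]_n -> 'rV[R]_n -> R) (H K : M -> R) (x : M) : R :=
  mdiff A H x (xget (fun=> 0) [set X | hamiltonian_vf A Om K X] x).

Definition poisson_manifold n (M : Type) (A : atlas R n M)
    (br : (M -> R) -> (M -> R) -> M -> R) : Prop :=
  smooth_manifold A /\
  forall H K L : M -> R, smooth_fun A H -> smooth_fun A K -> smooth_fun A L ->
  [/\ smooth_fun A (br H K),
      (forall (a : R) x, br (fun y => a * H y + K y) L x =
                         a * br H L x + br K L x),
      (forall x, br H K x = - br K H x),
      (forall x, br (fun y => H y * K y) L x =
                 H x * br K L x + br H L x * K x) &
      (forall x, br (br H K) L x + br (br K L) H x + br (br L H) K x = 0)].

End Manifolds.

Section LieGroups.
Context {R : realType} {n : nat} {G : groupType} (A : atlas R n G).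

Definition lie_group : Prop :=
  [/\ smooth_manifold A,
      smooth_map (prod_atlas A A) A (fun x => (x.1 * x.2)%g) &
      smooth_map A A (fun x => (x^-1)%g)].

(* The Lie algebra T_e G is 'rV[R]_n. *)
Definition Ad (g : G) : 'rV[R]_n -> 'rV[R]_n :=
  tmap A A (fun h => g * h * g^-1)%g 1%g.

(* [xi, eta] = ad_xi eta with ad = T_e Ad, that is, the derivative at t = 0 of
   Ad_(exp (t xi)) eta. *)
Definition bracket (xi eta : 'rV[R]_n) : 'rV[R]_n :=
  mdiff A (fun g => Ad g eta) 1%g xi.

(* gam is t |-> exp (t xi): a homomorphism with gam'(0) = xi. *)
Definition one_parameter_subgroup (xi : 'rV[R]_n) (gam : R -> G) : Prop :=
  [/\ (forall s t, gam (s + t) = (gam s * gam t)%g),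
      (\forall t \near (0 : R), dom (chart_at A 1%g) (gam t)) &
      is_derive (0 : R) (1 : R) (crd (chart_at A 1%g) \o gam) xi].

Definition adstar (xi mu : 'rV[R]_n) : 'rV[R]_n :=
  dual_repr (fun eta => - pairing mu (bracket xi eta)).

(* T_e^* R_g : T_g^* G -> T_e^* G *)
Definition TRstar (g : G) (alpha : 'rV[R]_n) : 'rV[R]_n :=
  dual_repr (fun xi => pairing alpha (tmap A A (fun h => h * g)%g 1%g xi)).

(* T_g^* R_(g^-1) : T_e^* G -> T_g^* G *)
Definition TRVstar (g : G) (mu : 'rV[R]_n) : 'rV[R]_n :=
  dual_repr (fun v => pairing mu (tmap A A (fun h => h * g^-1)%g g v)).

Definition TG : atlas R (n + n) (G * 'rV[R]_n) := prod_atlas A (vec_atlas n).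

Definition tg_mul (x y : G * 'rV[R]_n) : G * 'rV[R]_n :=
  ((x.1 * y.1)%g, x.2 + Ad x.1 y.2).

Definition tg_inv (x : G * 'rV[R]_n) : G * 'rV[R]_n :=
  ((x.1^-1)%g, - Ad (x.1^-1)%g x.2).

Definition tg_Ad (x : G * 'rV[R]_n) : 'rV[R]_(n + n) -> 'rV[R]_(n + n) :=
  tmap TG TG (fun y => tg_mul (tg_mul x y) (tg_inv x)) (1%g, 0).

(* The left coadjoint action of TG: m |-> m \o Ad_(x^-1). *)
Definition tg_coAd (x : G * 'rV[R]_n) (m : 'rV[R]_(n + n)) : 'rV[R]_(n + n) :=
  dual_repr (fun v => pairing m (tg_Ad (tg_inv x) v)).

(* The trivialized T^*TG, the product of G, g_1, g_2^* and g_3^*, with elements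
   ((g, xi), (mu, nu)). *)
Definition TTG_triv :
    atlas R ((n + n) + (n + n)) ((G * 'rV[R]_n) * ('rV[R]_n * 'rV[R]_n)) :=
  prod_atlas TG (prod_atlas (vec_atlas n) (vec_atlas n)).

(* The semidirect product of TG and Lie(TG)^*, for the coadjoint action. *)
Definition ttg_mul (p q : (G * 'rV[R]_n) * ('rV[R]_n * 'rV[R]_n)) :
    (G * 'rV[R]_n) * ('rV[R]_n * 'rV[R]_n) :=
  let m := tg_coAd p.1 (row_mx q.2.1 q.2.2) in
  (tg_mul p.1 q.1, (p.2.1 + lsubmx m, p.2.2 + rsubmx m)).

Definition TTG : atlas R ((n + n) + (n + n)) ((G * 'rV[R]_n) * 'rV[R]_(n + n)) :=
  cotangent TG.

(* A covector (alpha_g, alpha_xi) of G x g at (g, xi) is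
   row_mx alpha_g alpha_xi. *)
Definition triv (z : (G * 'rV[R]_n) * 'rV[R]_(n + n)) :
    (G * 'rV[R]_n) * ('rV[R]_n * 'rV[R]_n) :=
  let: ((g, xi), alpha) := z in
  ((g, xi), (TRstar g (lsubmx alpha) + adstar xi (rsubmx alpha),
             rsubmx alpha)).

(* The inverse of [triv]. *)
Definition untriv (p : (G * 'rV[R]_n) * ('rV[R]_n * 'rV[R]_n)) :
    (G * 'rV[R]_n) * 'rV[R]_(n + n) :=
  let: ((g, xi), (mu, nu)) := p in
  ((g, xi), row_mx (TRVstar g (mu - adstar xi nu)) nu).

Definition Omega : (G * 'rV[R]_n) * ('rV[R]_n * 'rV[R]_n) ->
    'rV[R]_((n + n) + (n + n)) -> 'rV[R]_((n + n) + (n + n)) -> R :=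
  pullback2 TTG_triv TTG untriv (ext_d TTG (liouville TG)).

Definition g_incl (xi : 'rV[R]_n) : (G * 'rV[R]_n) * ('rV[R]_n * 'rV[R]_n) :=
  ((1%g, xi), (0, 0)).

Definition g_act (p : (G * 'rV[R]_n) * ('rV[R]_n * 'rV[R]_n))
    (xi : 'rV[R]_n) : (G * 'rV[R]_n) * ('rV[R]_n * 'rV[R]_n) :=
  let: ((h, eta), (mu, nu)) := p in ((h, eta + Ad h xi), (mu, nu)).

(* The reduced space, the product of G, g_2^* and g_3^*, with elements
   (g, (mu, nu)). *)
Definition reduced : atlas R (n + (n + n)) (G * ('rV[R]_n * 'rV[R]_n)) :=
  prod_atlas A (prod_atlas (vec_atlas n) (vec_atlas n)).

Definition red_proj (p : (G * 'rV[R]_n) * ('rV[R]_n * 'rV[R]_n)) :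
    G * ('rV[R]_n * 'rV[R]_n) := (p.1.1, p.2).

(* The partial derivatives of H at (g, (mu, nu)): [d_g] is a covector at g,
   [d_mu] and [d_nu] are elements of g. *)
Definition d_g (H : G * ('rV[R]_n * 'rV[R]_n) -> R) g mu nu : 'rV[R]_n :=
  dual_repr (mdiff A (fun h => H (h, (mu, nu))) g).
Definition d_mu (H : G * ('rV[R]_n * 'rV[R]_n) -> R) g mu nu : 'rV[R]_n :=
  dual_repr ('d (fun mu' => H (g, (mu', nu))) mu).
Definition d_nu (H : G * ('rV[R]_n * 'rV[R]_n) -> R) g mu nu : 'rV[R]_n :=
  dual_repr ('d (fun nu' => H (g, (mu, nu'))) nu).

Definition red_bracket (H K : G * ('rV[R]_n * 'rV[R]_n) -> R)
    (x : G * ('rV[R]_n * 'rV[R]_n)) : R :=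
  let: (g, (mu, nu)) := x in
  pairing (TRstar g (d_g H g mu nu)) (d_mu K g mu nu)
  - pairing (TRstar g (d_g K g mu nu)) (d_mu H g mu nu)
  + pairing mu (bracket (d_mu H g mu nu) (d_mu K g mu nu))
  + pairing nu (bracket (d_mu H g mu nu) (d_nu K g mu nu)
                - bracket (d_mu K g mu nu) (d_nu H g mu nu)).

End LieGroups.

(* Main.v *)
(* In a chart q of G, the right-invariant frame R(q) = T_e R_q turns the
   trivialization of T^*TG into the change of coordinates
     (q, xi, p, pi) |-> (q, xi, mu, nu) = (q, xi, R(q)^T p + ad^*_xi pi, pi).
   In (q, xi, p, pi) the form d theta is the canonical one, which gives the
   Hamiltonian vector fields and reduces the bracket to the canonical bracket of
   functions of (q, R(q)^T p + ad^*_xi pi, pi).  The Lie algebra terms of the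
   reduced bracket then come from the commutator of right-invariant vector
   fields, which is a consequence of the symmetry of second derivatives, and from
   the Jacobi identity of g.  The same computation shows that the reduced bracket
   is locally a canonical bracket of pulled back functions, so that it satisfies
   the Jacobi identity. *)
Require Import Defs.
From HB Require Import structures.
From mathcomp Require Import all_boot all_order all_algebra.
From mathcomp Require Import all_classical all_reals all_analysis.
From mathcomp Require Import ring lra.

Set Implicit Arguments.
Unset Strict Implicit.
Unset Printing Implicit Defensive.

Import Order.TTheory GRing.Theory Num.Theory.
Import numFieldNormedType.Exports.

Local Open Scope classical_set_scope.
Local Open Scope ring_scope.

(** * Smooth maps between normed spaces *)

(** A tangent vector is stored as its components in the preferred chart of its base point, and this
    chart may jump from one point to the next, so expressions such as [tmap] or [tpar] need not be
    smooth in the base point. Every object is therefore read in a fixed chart [i], where the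
    passages through preferred charts cancel by the chain rule. Coordinates are total maps that
    carry meaning only on their domains, so these identities hold on neighbourhoods only and
    everything rests on germs: [smooth_at] for maps between normed spaces, [plot] for maps into a
    manifold. The algebra of g comes from the group law: antisymmetry because the bracket is a
    commutator of right-invariant fields, the Jacobi identity by differentiating the invariance of
    the bracket under Ad. With d theta = dp ^ dq, the convention i_X Omega = -dH gives X_H = (dH/dp,
    -dH/dq), and dH(X_K) is the canonical bracket with its usual sign. *)

(* A sealed copy of ['d f x v]: comparing two different occurrences of ['d]
   makes unification unfold the choice operator hidden in its definition. *)
HB.lock Definition dif (R : realType) (V W : normedModType R) (f : V -> W) (x v : V) : W :=
  'd f x v.
Arguments dif {R V W} f x v.

Section Differentiation.
Context {R : realType}.
Implicit Types V W : normedModType R.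

(** The first-order expansion at [x] depends only on the germ of the function, and [diff_unique]
    recovers the differential from it. Identities that hold only near a point, such as those between
    charts, can thus be differentiated. *)
Lemma near_eq_is_diff V W (f g : V -> W) (x : V) :
  (\near x, f x = g x) -> differentiable f x ->
  differentiable g x /\ 'd g x = 'd f x :> (V -> W).
Proof.
move=> fg df.
have E : g \o shift x = cst (g x) + 'd f x +o_ 0 id.
  apply/eqaddoP => e e0.
  have := diff_locally df => /eqaddoP /(_ _ e0).
  have fg0 : \forall y \near (0 : V), f (y + x) = g (y + x).
    move: fg; rewrite (near_shift 0).
    by apply: filterS => y /=; rewrite subr0.
  rewrite (nbhs_singleton fg).
  by apply: filterS2 fg0 => y; rewrite /= !fctE /= => ->.
have U := diff_unique (diff_continuous df) E.
split; last exact: U.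
by apply/diff_locallyP; rewrite U; split; [exact: diff_continuous|exact: E].
Qed.

Lemma continuous_linear_rV m W (f : {linear 'rV[R]_m -> W}) : continuous f.
Proof.
have -> : (f : _ -> _) = fun x => \sum_i x ord0 i *: f (delta_mx ord0 i).
  apply/funext => x; rewrite {1}(row_sum_delta x) linear_sum.
  by apply: eq_bigr => i _; rewrite linearZ.
apply: (@continuous_big W _ +%R 0 xpredT) => [|i _ x]; first exact: add_continuous.
exact/continuousZr_tmp/coord_continuous.
Qed.

Lemma scale_is_bilinear W :
  bilinear_for (GRing.Scale.Law.clone _ _ *:%R _) (GRing.Scale.Law.clone _ _ *:%R _)
    (@GRing.scale R W : R^o -> W -> W).
Proof.
split=> [u'|u] a x y /=; first by rewrite scalerDl scalerA.
by rewrite scalerDr !scalerA mulrC.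
Qed.

(** The product rule is the chain rule for y |-> (f y, g y) followed by scaling, a continuous
    bilinear map once the scalars are seen as the module [R^o]. *)
Lemma is_diff_scale V W (f df : V -> R) (g dg : V -> W) (x : V) :
  is_diff x f df -> is_diff x g dg ->
  is_diff x (fun y => f y *: g y) (fun v => df v *: g x + f x *: dg v).
Proof.
move=> fx gx.
pose bM := bilinear_isBilinear.Build R R^o W W _ _ _ (scale_is_bilinear W).
pose b : {bilinear R^o -> W -> W} := HB.pack (@GRing.scale R W : R^o -> W -> W) bM.
have cb : continuous (fun p : R^o * W => b p.1 p.2) by exact: scale_continuous.
have -> : (fun y => f y *: g y) = (fun p : R^o * W => b p.1 p.2) \o (fun y => (f y, g y)).
  by [].
have db := differentiable_bilin (f x : R^o, g x) cb.
have dp : differentiable (fun y => (f y : R^o, g y)) x.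
  by apply: differentiable_pair; exact: ex_diff.
split; first exact: differentiable_comp.
rewrite diff_comp // diff_bilin // diff_pair; try exact: ex_diff.
by apply/funext => v /=; rewrite !diff_val /b /= addrC.
Qed.

(** * Mean value theorem along lines and second differences *)

Lemma derive_line V W (f : V -> W) (a u : V) (s : R) :
  differentiable f (a + s *: u) ->
  is_derive s (1 : R) (fun t => f (a + t *: u)) ('D_u f (a + s *: u)).
Proof.
move=> df.
have -> : (fun t => f (a + t *: u)) = f \o (fun t : R => a + t *: u) by [].
have dl : is_diff s (fun t : R => a + t *: u) (0 + *:%R^~ u) by exact: is_diffD.
have dl' : differentiable (fun t : R => a + t *: u) s by exact: ex_diff.
have dc := differentiable_comp dl' df.
split; first exact: diff_derivable.
by rewrite !deriveE // diff_comp //= diff_val /= fctE add0r scale1r.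
Qed.

Lemma MVT_line V (f : V -> R) (a u : V) (h : R) : 0 < h ->
  (forall s, 0 <= s <= h -> differentiable f (a + s *: u)) ->
  exists2 s, 0 <= s <= h & f (a + h *: u) - f a = h * 'D_u f (a + s *: u).
Proof.
move=> h0 df.
have [||s /itvP sh] := @MVT_segment R (fun t => f (a + t *: u)) (fun t => 'D_u f (a + t *: u)) 0 h (ltW h0).
- by move=> s /itvP sh; apply: derive_line; apply: df; rewrite !sh.
- apply: derivable_within_continuous => s /itvP sh.
  by apply: ex_derive; apply: derive_line; apply: df; rewrite !sh.
- rewrite scale0r addr0 subr0 mulrC => E.
  by exists s => //; rewrite !sh.
Qed.

(** The mean value theorem is applied to y |-> f (y + h v) - f y along [u], and then to ['D_u f]
    along [v]. *)
Lemma second_difference_mean V (f : V -> R) (x u v : V) (h : R) : 0 < h ->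
  (forall s t, 0 <= s <= h -> 0 <= t <= h ->
     differentiable f (x + s *: u + t *: v) /\
     differentiable ('D_u f) (x + s *: u + t *: v)) ->
  exists s t, [/\ 0 <= s <= h, 0 <= t <= h &
    f (x + h *: u + h *: v) - f (x + h *: u) - (f (x + h *: v) - f x) =
    h * (h * 'D_v ('D_u f) (x + s *: u + t *: v))].
Proof.
move=> h0 df.
have h1 : 0 <= h <= h by rewrite lexx (ltW h0).
have h2 : 0 <= (0 : R) <= h by rewrite lexx (ltW h0).
have dF s : 0 <= s <= h -> is_diff (x + s *: u) (fun y => f (y + h *: v) - f y)
   (fun w => 'd f (x + s *: u + h *: v) w - 'd f (x + s *: u) w).
  move=> sh; apply: is_diffB; last first.
    apply: differentiableP; have [+ _] := df _ _ sh h2.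
    by rewrite scale0r addr0.
  have -> : (fun y => f (y + h *: v)) = f \o (fun y => y + h *: v) by [].
  have d1 : is_diff (x + s *: u) (fun y => y + h *: v) (id + 0) by exact: is_diffD.
  have d2 : is_diff (x + s *: u + h *: v) f ('d f (x + s *: u + h *: v)).
    by apply: differentiableP; exact: (df _ _ sh h1).1.
  apply: is_diff_eq (is_diff_comp d1 d2) _.
  by apply/funext => w /=; rewrite fctE addr0.
have [s sh E] := @MVT_line V (fun y => f (y + h *: v) - f y) x u h h0 (fun s sh => @ex_diff _ _ _ _ _ _ _ (dF s sh)).
have [t th E2] := @MVT_line V ('D_u f) (x + s *: u) v h h0 (fun t th => (df _ _ sh th).2).
exists s, t; split=> //.
rewrite -E2 E; congr (_ * _).
have D0 := dF s sh.
rewrite deriveE; last exact: ex_diff.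
rewrite diff_val.
have d1 := (df _ _ sh h1).1.
have d2 : differentiable f (x + s *: u).
  by have := (df _ _ sh h2).1; rewrite scale0r addr0.
by rewrite -(deriveE _ d1) -(deriveE _ d2).
Qed.

(** * Functions of class C^k *)

(** [Ck_on] asks at each point of [U] for a property of the total function [f], whose derivatives
    are taken in the whole space; hence it can be tested on singletons. *)
Lemma Ck_on_pointwise V W k (U : set V) (f : V -> W) :
  (forall x, U x -> Ck_on k [set x] f) -> Ck_on k U f.
Proof.
elim: k f => [|k IH] f /= h; first by move=> x Ux; exact: (h x Ux x).
split=> [x Ux|v]; first exact: (h x Ux).1.
by apply: IH => x Ux; exact: (h x Ux).2.
Qed.

Lemma Ck_on_sub V W k (U U' : set V) (f : V -> W) :
  U `<=` U' -> Ck_on k U' f -> Ck_on k U f.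
Proof.
move=> UU; elim: k f => [|k IH] f /=; first by move=> h x /UU; exact: h.
by move=> [h1 h2]; split=> [x /UU /h1|v] //; exact: IH.
Qed.

(** As [U] is open, [f] and [g] have the same germ at each of its points, so their directional
    derivatives agree on [U] again, which feeds the induction. *)
Lemma Ck_on_ext V W k (U : set V) (f g : V -> W) : open U ->
  (forall x, U x -> f x = g x) -> Ck_on k U f -> Ck_on k U g.
Proof.
move=> oU; elim: k f g => [|k IH] f g fg /=.
  move=> h x Ux; have hx : f y @[y --> x] --> f x := h x Ux.
  suff : g y @[y --> x] --> g x by [].
  rewrite -(fg x Ux); apply: cvg_trans hx; apply: near_eq_cvg.
  exact: filterS (open_nbhs_nbhs (conj oU Ux)).
move=> [h1 h2]; split=> [x Ux|v].
  apply: (near_eq_is_diff _ (h1 x Ux)).1.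
  exact: filterS (open_nbhs_nbhs (conj oU Ux)).
apply: IH (h2 v) => x Ux; apply: near_eq_derive.
exact: filterS (open_nbhs_nbhs (conj oU Ux)).
Qed.

Lemma Ck_onW V W k (U : set V) (f : V -> W) : Ck_on k.+1 U f -> Ck_on k U f.
Proof.
elim: k f => [|k IH] f [h1 h2].
  by move=> x /h1 /differentiable_continuous.
by split=> // v; exact: IH.
Qed.

Lemma Ck_on_cst V W k (U : set V) (a : W) : Ck_on k U (fun _ : V => a).
Proof.
elim: k a => [|k IH] a; first by move=> x _; exact: cst_continuous.
split=> [x _|v]; first exact: differentiable_cst.
suff -> : 'D_v (fun _ : V => a) = fun=> 0 by exact: IH.
by apply/funext => x; exact: derive_cst.
Qed.

Lemma Ck_onD V W k (U : set V) (f g : V -> W) : open U ->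
  Ck_on k U f -> Ck_on k U g -> Ck_on k U (fun x => f x + g x).
Proof.
move=> oU; elim: k f g => [|k IH] f g /=.
  by move=> hf hg x Ux; apply: continuousD; [exact: hf|exact: hg].
move=> [hf df] [hg dg]; split=> [x Ux|v].
  by apply: differentiableD; [exact: hf|exact: hg].
apply: Ck_on_ext (IH _ _ (df v) (dg v)) => // x Ux.
by rewrite -deriveD //; apply: diff_derivable; [exact: hf|exact: hg].
Qed.

Lemma Ck_onZ V W k (U : set V) (f : V -> R) (g : V -> W) : open U ->
  Ck_on k U f -> Ck_on k U g -> Ck_on k U (fun x => f x *: g x).
Proof.
move=> oU; elim: k f g => [|k IH] f g.
  by move=> hf hg x Ux; apply: continuousZ; [exact: hf|exact: hg].
move=> Cf Cg; have [[hf df] [hg dg]] := (Cf, Cg).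
have dfg x : U x -> is_diff x (fun y => f y *: g y)
    (fun v => 'd f x v *: g x + f x *: 'd g x v).
  by move=> Ux; apply: is_diff_scale; apply: differentiableP; [exact: hf|exact: hg].
split=> [x /dfg [] //|v].
apply: (@Ck_on_ext _ _ _ _ (fun x => 'D_v f x *: g x + f x *: 'D_v g x)) => //.
  move=> x Ux; have D := dfg _ Ux.
  rewrite [RHS]deriveE; last by case: D.
  by rewrite diff_val !deriveE //; [exact: hg|exact: hf].
by apply: Ck_onD => //; apply: IH; [exact: df|exact: Ck_onW|exact: Ck_onW|exact: dg].
Qed.

Lemma Ck_on_linear V W W' k (U : set V) (l : {linear W -> W'}) (f : V -> W) :
  continuous l -> open U -> Ck_on k U f -> Ck_on k U (l \o f).
Proof.
move=> cl oU; elim: k f => [|k IH] f.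
  by move=> hf x Ux; apply: continuous_comp; [exact: hf|exact: cl].
move=> [hf df].
have dl y : is_diff y l l.
  by split; [exact: linear_differentiable|exact: diff_lin].
split=> [x Ux|v].
  by apply: differentiable_comp; [exact: hf|exact: ex_diff].
apply: Ck_on_ext (IH _ (df v)) => // x Ux /=.
rewrite [RHS]deriveE; last first.
  by apply: differentiable_comp; [exact: hf|exact: ex_diff].
by rewrite diff_comp ?diff_val //= ?deriveE //; exact: hf.
Qed.

Lemma Ck_on_sum V W k (U : set V) (I : Type) (r : seq I) (P : pred I) (f : I -> V -> W) : open U ->
  (forall i, P i -> Ck_on k U (f i)) -> Ck_on k U (fun x => \sum_(i <- r | P i) f i x).
Proof.
move=> oU h; elim: r => [|i r IH].
  by under eq_fun do rewrite big_nil; exact: Ck_on_cst.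
under eq_fun do rewrite big_cons.
case: (boolP (P i)) => Pi //; apply: Ck_onD => //; exact: h.
Qed.

Lemma diff_rV m V (f : V -> 'rV[R]_m) (x v : V) (W : normedModType R) (l : {linear 'rV[R]_m -> W}) :
  l ('d f x v) = \sum_i ('d f x v) ord0 i *: l (delta_mx ord0 i).
Proof.
by rewrite {1}(row_sum_delta ('d f x v)) linear_sum; apply: eq_bigr => i _; rewrite linearZ.
Qed.

Definition coordl m (i : 'I_m) (x : 'rV[R]_m) : R := x ord0 i.
Lemma coordl_is_linear m (i : 'I_m) : linear (@coordl m i).
Proof. by move=> a x y; rewrite /coordl !mxE. Qed.
HB.instance Definition _ m i := GRing.isLinear.Build R 'rV[R]_m R _ (@coordl m i) (@coordl_is_linear m i).

(** The derivative of the composite at [x] is that of [g] in the direction ['D_v f x], which moves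
    with [x]. Expanding this direction in the basis of R^m leaves derivatives of [g] in fixed
    directions, to which the induction applies. *)
Lemma Ck_on_comp m V W k (U : set V) (U' : set 'rV[R]_m) (f : V -> 'rV[R]_m)
    (g : 'rV[R]_m -> W) : open U -> open U' -> (forall x, U x -> U' (f x)) ->
  Ck_on k U f -> Ck_on k U' g -> Ck_on k U (g \o f).
Proof.
move=> oU oU' fU; elim: k f g fU => [|k IH] f g fU.
  by move=> hf hg x Ux; apply: continuous_comp; [exact: hf|apply: hg; exact: fU].
move=> Cf Cg; have [[hf df] [hg dg]] := (Cf, Cg).
have dgf x : U x -> differentiable (g \o f) x.
  by move=> Ux; apply: differentiable_comp; [exact: hf|apply: hg; exact: fU].
split=> // v.
apply: (@Ck_on_ext _ _ _ _ (fun x => \sum_i 'D_v f x ord0 i *: 'D_(delta_mx ord0 i) g (f x))) => //.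
  move=> x Ux; rewrite [RHS]deriveE; last exact: dgf.
  rewrite diff_comp; [|exact: hf|by apply: hg; exact: fU].
  rewrite /= diff_rV; apply: eq_bigr => i _.
  by rewrite deriveE ?deriveE //; [apply: hg; exact: fU|exact: hf].
apply: Ck_on_sum => // i _; apply: Ck_onZ => //.
  apply: (@Ck_on_linear _ _ _ _ _ (@coordl m i)); [exact: coord_continuous|exact: oU|exact: df].
by apply: (IH f ('D_(delta_mx ord0 i) g)); [exact: fU|exact: Ck_onW|exact: dg].
Qed.

(** * Smoothness at a point *)

(** One neighbourhood serves all orders of differentiability, so the set of points with this
    property is open and no domain has to be carried along. *)
Definition smooth_at V W (f : V -> W) (x : V) : Prop :=
  exists U, [/\ open U, U x & smooth_on U f].

Lemma smooth_onP V W (U : set V) (f : V -> W) : open U ->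
  smooth_on U f <-> forall x, U x -> smooth_at f x.
Proof.
move=> oU; split=> [h x Ux|h k]; first by exists U.
apply: Ck_on_pointwise => x /h [U' [_ U'x /(_ k)]].
by apply: Ck_on_sub => y ->.
Qed.

Lemma smooth_at_near V W (f : V -> W) x : smooth_at f x -> \near x, smooth_at f x.
Proof.
move=> [U [oU Ux h]]; apply: filterS (open_nbhs_nbhs (conj oU Ux)) => y Uy.
by exists U.
Qed.

Lemma smooth_at_differentiable V W (f : V -> W) x : smooth_at f x -> differentiable f x.
Proof. by move=> [U [oU Ux /(_ 1%N) [h _]]]; exact: h. Qed.

Lemma smooth_at_continuous V W (f : V -> W) x : smooth_at f x -> {for x, continuous f}.
Proof. by move=> /smooth_at_differentiable /differentiable_continuous. Qed.

Lemma smooth_at_ext V W (f g : V -> W) x : (\near x, f x = g x) ->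
  smooth_at f x -> smooth_at g x.
Proof.
rewrite /prop_near1 nbhsE /= => -[N [oO Ox] h] [U [oU Ux hU]].
exists (U `&` N); split=> //; first exact: openI.
move=> k; apply: (@Ck_on_ext _ _ _ _ f) => //; first exact: openI.
  by move=> y [_ /h].
by apply: Ck_on_sub (hU k) => y [].
Qed.

Lemma smooth_at_derive V W (f : V -> W) x v : smooth_at f x -> smooth_at ('D_v f) x.
Proof. by move=> [U [oU Ux h]]; exists U; split=> // k; exact: (h k.+1).2. Qed.

Lemma smooth_at_cst V W (a : W) (x : V) : smooth_at (fun=> a) x.
Proof. by exists setT; split=> //; [exact: openT|move=> k; exact: Ck_on_cst]. Qed.

Lemma smooth_atD V W (f g : V -> W) x : smooth_at f x -> smooth_at g x ->
  smooth_at (fun y => f y + g y) x.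
Proof.
move=> [U [oU Ux h]] [U' [oU' U'x h']]; exists (U `&` U'); split=> //; first exact: openI.
move=> k; apply: Ck_onD; first exact: openI.
  by apply: Ck_on_sub (h k) => y [].
by apply: Ck_on_sub (h' k) => y [].
Qed.

Lemma smooth_atZ V W (f : V -> R) (g : V -> W) x : smooth_at f x -> smooth_at g x ->
  smooth_at (fun y => f y *: g y) x.
Proof.
move=> [U [oU Ux h]] [U' [oU' U'x h']]; exists (U `&` U'); split=> //; first exact: openI.
move=> k; apply: Ck_onZ; first exact: openI.
  by apply: Ck_on_sub (h k) => y [].
by apply: Ck_on_sub (h' k) => y [].
Qed.

Lemma smooth_atM V (f g : V -> R) x : smooth_at f x -> smooth_at g x ->
  smooth_at (fun y => f y * g y) x.
Proof. exact: smooth_atZ. Qed.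

Lemma smooth_at_sum V W (I : Type) (r : seq I) (P : pred I) (f : I -> V -> W) x :
  (forall i, P i -> smooth_at (f i) x) -> smooth_at (fun y => \sum_(i <- r | P i) f i y) x.
Proof.
move=> h; elim: r => [|i r IH].
  by under eq_fun do rewrite big_nil; exact: smooth_at_cst.
under eq_fun do rewrite big_cons.
case: (boolP (P i)) => Pi //; apply: smooth_atD => //; exact: h.
Qed.

Lemma smooth_at_linear V m W (l : {linear 'rV[R]_m -> W}) (f : V -> 'rV[R]_m) x :
  smooth_at f x -> smooth_at (fun y => l (f y)) x.
Proof.
move=> [U [oU Ux h]]; exists U; split=> // k.
by apply: (@Ck_on_linear _ _ _ _ _ l) => //; exact: continuous_linear_rV.
Qed.

Lemma smooth_atN V W (f : V -> W) x : smooth_at f x -> smooth_at (fun y => - f y) x.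
Proof.
move=> h; apply: (@smooth_at_ext _ _ (fun y => -1 *: f y)).
  by near=> y; rewrite scaleN1r.
by apply: smooth_atZ => //; exact: smooth_at_cst.
Unshelve. all: by end_near. Qed.

Lemma smooth_atB V W (f g : V -> W) x : smooth_at f x -> smooth_at g x ->
  smooth_at (fun y => f y - g y) x.
Proof. by move=> hf hg; apply: smooth_atD => //; exact: smooth_atN. Qed.

Lemma smooth_at_id V (x : V) : smooth_at id x.
Proof.
exists setT; split=> //; first exact: openT.
case=> [|k]; first by move=> y _; exact: cvg_id.
split=> [y _|v]; first exact: ex_diff.
suff -> : 'D_v id = fun=> v by exact: Ck_on_cst.
by apply/funext => y; exact: derive_id.
Qed.

Lemma smooth_at_comp m V W (f : V -> 'rV[R]_m) (g : 'rV[R]_m -> W) x :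
  smooth_at f x -> smooth_at g (f x) -> smooth_at (fun y => g (f y)) x.
Proof.
move=> hf [U' [oU' U'x h']]; have [U [oU Ux h]] := hf.
have := smooth_at_continuous hf (open_nbhs_nbhs (conj oU' U'x)).
rewrite nbhsE /= => -[N [oO Ox] fO].
exists (U `&` N); split=> //; first exact: openI.
move=> k; apply: (@Ck_on_comp _ _ _ _ _ U' f g) => //; first exact: openI.
  by move=> y [_ /fO].
by apply: Ck_on_sub (h k) => y [].
Qed.

Lemma smooth_at_coord m V (f : V -> 'rV[R]_m) x :
  smooth_at f x <-> forall i, smooth_at (fun y => f y ord0 i) x.
Proof.
split=> [h i|h]; first exact: (@smooth_at_linear _ _ _ (@coordl m i)).
apply: (@smooth_at_ext _ _ (fun y => \sum_i f y ord0 i *: delta_mx ord0 i)).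
  by near=> y; rewrite -row_sum_delta.
by apply: smooth_at_sum => i _; apply: smooth_atZ => //; exact: smooth_at_cst.
Unshelve. all: by end_near. Qed.

Lemma smooth_at_row_mx m n V (f : V -> 'rV[R]_m) (g : V -> 'rV[R]_n) x :
  smooth_at f x -> smooth_at g x -> smooth_at (fun y => row_mx (f y) (g y)) x.
Proof.
move=> /smooth_at_coord hf /smooth_at_coord hg; apply/smooth_at_coord => i.
case: (splitP i) => j ij.
  have -> : i = lshift n j by exact: val_inj.
  by under eq_fun do rewrite row_mxEl.
have -> : i = rshift m j by exact: val_inj.
by under eq_fun do rewrite row_mxEr.
Qed.

Lemma smooth_at_lsubmx m n V (f : V -> 'rV[R]_(m + n)) x :
  smooth_at f x -> smooth_at (fun y => lsubmx (f y)) x.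
Proof. exact: smooth_at_linear. Qed.

Lemma smooth_at_rsubmx m n V (f : V -> 'rV[R]_(m + n)) x :
  smooth_at f x -> smooth_at (fun y => rsubmx (f y)) x.
Proof. exact: smooth_at_linear. Qed.

(** Expanding [u y] in the basis turns the differential into derivatives in fixed directions, which
    are smooth. Both agree wherever [f] is smooth at [g y], hence for [y] near [x]. *)
Lemma smooth_at_diff m W (f : 'rV[R]_m -> W) V (g u : V -> 'rV[R]_m) x :
  smooth_at g x -> smooth_at u x -> smooth_at f (g x) ->
  smooth_at (fun y => 'd f (g y) (u y)) x.
Proof.
move=> hg hu hf.
apply: (@smooth_at_ext _ _ (fun y => \sum_i u y ord0 i *: 'D_(delta_mx ord0 i) f (g y))).
  have H : \forall y \near x, smooth_at f (g y) := smooth_at_continuous hg (smooth_at_near hf).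
  apply: filterS H => y /= hy.
  rewrite [in RHS](row_sum_delta (u y)) linear_sum; apply: eq_bigr => i _.
  by rewrite linearZ -deriveE //; exact: smooth_at_differentiable.
apply: smooth_at_sum => i _; apply: smooth_atZ.
  by move/smooth_at_coord : hu.
exact: (smooth_at_comp hg (smooth_at_derive _ hf)).
Qed.

(** * Symmetry of second derivatives *)

(** Arbitrarily close to [x] the two functions share a value, possibly at different points, and
    continuity passes this to the limit. The mean value theorem produces such points for the two
    mixed derivatives. *)
Lemma continuous_eq_near V (g1 g2 : V -> R) (x : V) (d0 : R) : 0 < d0 ->
  {for x, continuous g1} -> {for x, continuous g2} ->
  (forall d, 0 < d <= d0 -> exists y z, [/\ ball x d y, ball x d z & g1 y = g2 z]) ->
  g1 x = g2 x.
Proof.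
move=> d00 c1 c2 h; apply/eqP; rewrite -subr_eq0 -normr_le0; apply/ler_addgt0Pl => e e0.
rewrite addr0; have e2 : 0 < e / 2 by rewrite divr_gt0.
have /cvgrPdist_lt /(_ _ e2) n1 := c1.
have /cvgrPdist_lt /(_ _ e2) n2 := c2.
have : nbhs x ((fun y => `|g1 x - g1 y| < e / 2) `&` (fun y => `|g2 x - g2 y| < e / 2)).
  by apply: filterI; [exact: n1|exact: n2].
move=> /nbhs_ballP [d /= dp hd].
have [|y [z [/(ball_sym) By Bz E]]] := h (Num.min d d0).
  by rewrite lt_min dp d00 ge_min lexx orbT.
have {}By : ball x d y.
  by apply: (le_ball _ (ball_sym By)); rewrite ge_min lexx.
have {}Bz : ball x d z.
  by apply: (le_ball _ Bz); rewrite ge_min lexx.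
have [/= H1 _] := hd _ By; have [/= _ H2] := hd _ Bz.
rewrite (splitr e); apply: le_trans (ltW (ltrD H1 H2)).
rewrite E -[X in `|X - _|](subrK (g2 z)) -addrA (le_trans (ler_normD _ _)) // lerD //.
by rewrite distrC.
Qed.

(* The second difference of f along u and v is evaluated by the mean value
   theorem in the two possible orders. *)
Lemma schwarz_real V (f : V -> R) (x u v : V) : smooth_at f x ->
  'D_v ('D_u f) x = 'D_u ('D_v f) x.
Proof.
move=> hf.
have /nbhs_ballP [d0 /= d00 hd] := smooth_at_near hf.
apply: (@continuous_eq_near V ('D_v ('D_u f)) ('D_u ('D_v f)) x d0 d00).
- exact: smooth_at_continuous (smooth_at_derive v (smooth_at_derive u hf)).
- exact: smooth_at_continuous (smooth_at_derive u (smooth_at_derive v hf)).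
move=> d /andP[dp dd0].
(* The parallelogram with sides [c *: u] and [c *: v] stays in the ball of radius [d]: the [1] keeps
   the denominator positive and the factor 1/2 makes the bound strict. *)
pose c := d / (1 + `|u| + `|v|) / 2.
have M0 : 0 < 1 + `|u| + `|v| by rewrite -addrA ltr_pwDl // addr_ge0.
have h0 : 0 < c by rewrite !divr_gt0.
have inb s t : 0 <= s <= c -> 0 <= t <= c -> ball x d (x + s *: u + t *: v).
  move=> /andP[s0 sc] /andP[t0 tc]; rewrite -ball_normE /=.
  rewrite -addrA opprD addrA subrr add0r normrN (le_lt_trans (ler_normD _ _)) //.
  rewrite !normrZ !ger0_norm //.
  apply: (@le_lt_trans _ _ (c * (1 + `|u| + `|v|))).
    have u0 := normr_ge0 u; have v0 := normr_ge0 v; nra.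
  have -> : c * (1 + `|u| + `|v|) = d / 2 by rewrite /c; field; rewrite gt_eqF.
  by rewrite ltr_pdivrMr // ltr_pMr // ltr1n.
have [|s [t [sh th E1]]] := @second_difference_mean V f x u v c h0.
  move=> s t sh th; have hs := hd _ (le_ball dd0 (inb s t sh th)).
  split; first exact: smooth_at_differentiable.
  exact/smooth_at_differentiable/smooth_at_derive.
have [|s' [t' [sh' th' E2]]] := @second_difference_mean V f x v u c h0.
  move=> s' t' sh' th'; have := inb t' s' th' sh'.
  rewrite addrAC => /(le_ball dd0) /hd hs.
  split; first exact: smooth_at_differentiable.
  exact/smooth_at_differentiable/smooth_at_derive.
exists (x + s *: u + t *: v), (x + s' *: v + t' *: u); split; first exact: inb.
  by rewrite addrAC; exact: inb.
apply: (mulfI (lt0r_neq0 h0)); apply: (mulfI (lt0r_neq0 h0)).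
apply: etrans (esym E1) (etrans _ E2).
have -> : x + c *: v + c *: u = x + c *: u + c *: v by rewrite addrAC.
move: (f (x + c *: u + c *: v)) (f (x + c *: u)) (f (x + c *: v)) (f x) => a1 a2 a3 a4.
ring.
Qed.

Lemma derive_coord V m (f : V -> 'rV[R]_m) (x w : V) i : differentiable f x ->
  'D_w f x ord0 i = 'D_w (fun z => f z ord0 i) x.
Proof. by move=> /diff_derivable df; rewrite derive_mx ?mxE. Qed.

Lemma schwarz V m (f : V -> 'rV[R]_m) (x u v : V) : smooth_at f x ->
  'D_v ('D_u f) x = 'D_u ('D_v f) x.
Proof.
move=> hf.
have eqD w : \near x, forall i, 'D_w f x ord0 i = 'D_w (fun z => f z ord0 i) x.
  apply: filterS (smooth_at_near hf) => y hy i; apply: derive_coord.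
  exact: smooth_at_differentiable.
suff E w z i : 'D_z ('D_w f) x ord0 i = 'D_z ('D_w (fun z => f z ord0 i)) x.
  apply/rowP => i; apply: etrans (E u v i) (etrans _ (esym (E v u i))).
  by apply: schwarz_real; move/smooth_at_coord : hf.
rewrite derive_coord; last exact/smooth_at_differentiable/smooth_at_derive.
by apply: near_eq_derive; apply: filterS (eqD w) => y; apply.
Qed.

(** * Rules of differentiation for [dif] *)

Lemma difE V W (f : V -> W) x v : dif f x v = 'd f x v.
Proof. by rewrite dif.unlock. Qed.

Lemma dif_linear V W (f : V -> W) x : linear (dif f x).
Proof. by move=> a u v; rewrite !difE linearP. Qed.

HB.instance Definition _ V W (f : V -> W) x :=
  GRing.isLinear.Build R V W _ (dif f x) (@dif_linear V W f x).

Lemma dif0 V W (f : V -> W) x : dif f x 0 = 0.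
Proof. exact: (linear0 (dif f x)). Qed.

Lemma dif_derive V W (f : V -> W) x v : smooth_at f x -> dif f x v = 'D_v f x.
Proof. by move=> /smooth_at_differentiable d; rewrite difE deriveE. Qed.

Lemma is_diff_dif V W (f df : V -> W) x v : is_diff x f df -> dif f x v = df v.
Proof. by move=> D; rewrite difE diff_val. Qed.

Lemma smooth_is_diff V W (f : V -> W) x : smooth_at f x -> is_diff x f (dif f x).
Proof.
move=> /smooth_at_differentiable d; split=> //.
by apply/funext => v; rewrite difE.
Qed.

Lemma eq_dif V W (f g : V -> W) x v : f =1 g -> dif f x v = dif g x v.
Proof. by move=> /funext ->. Qed.

Lemma near_eq_dif V W (f g : V -> W) x v : (\near x, f x = g x) -> smooth_at f x ->
  dif g x v = dif f x v.
Proof.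
move=> fg /smooth_at_differentiable df; rewrite !difE.
by have [_ ->] := near_eq_is_diff fg df.
Qed.

Lemma dif_cst V W (a : W) (x v : V) : dif (fun=> a) x v = 0.
Proof. by rewrite (is_diff_dif _ (is_diff_cst a x)). Qed.

Lemma dif_id V (x v : V) : dif id x v = v.
Proof. by rewrite (is_diff_dif _ (is_diff_id x)). Qed.

Lemma difD V W (f g : V -> W) x v : smooth_at f x -> smooth_at g x ->
  dif (fun z => f z + g z) x v = dif f x v + dif g x v.
Proof.
move=> /smooth_is_diff df /smooth_is_diff dg.
exact: (is_diff_dif v (is_diffD df dg)).
Qed.

Lemma difN V W (f : V -> W) x v : smooth_at f x -> dif (fun z => - f z) x v = - dif f x v.
Proof. by move=> /smooth_is_diff df; exact: (is_diff_dif v (is_diffN df)). Qed.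

Lemma difB V W (f g : V -> W) x v : smooth_at f x -> smooth_at g x ->
  dif (fun z => f z - g z) x v = dif f x v - dif g x v.
Proof. by move=> sf sg; rewrite difD ?difN //; exact: smooth_atN. Qed.

Lemma difZ V W (f : V -> R) (g : V -> W) x v : smooth_at f x -> smooth_at g x ->
  dif (fun z => f z *: g z) x v = dif f x v *: g x + f x *: dif g x v.
Proof.
move=> /smooth_is_diff df /smooth_is_diff dg.
exact: (is_diff_dif v (is_diff_scale df dg)).
Qed.

Lemma difM V (f g : V -> R) x v : smooth_at f x -> smooth_at g x ->
  dif (fun z => f z * g z) x v = dif f x v * g x + f x * dif g x v.
Proof. exact: difZ. Qed.

Lemma dif_sum V W (I : Type) (r : seq I) (f : I -> V -> W) x v :
  (forall i, smooth_at (f i) x) ->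
  dif (fun z => \sum_(i <- r) f i z) x v = \sum_(i <- r) dif (f i) x v.
Proof.
move=> h; elim: r => [|i r IH].
  by under eq_fun do rewrite big_nil; rewrite big_nil dif_cst.
under eq_fun do rewrite big_cons.
rewrite big_cons difD ?IH //; exact: smooth_at_sum.
Qed.

Lemma dif_comp m V W (f : V -> 'rV[R]_m) (g : 'rV[R]_m -> W) x v :
  smooth_at f x -> smooth_at g (f x) ->
  dif (fun z => g (f z)) x v = dif g (f x) (dif f x v).
Proof.
move=> /smooth_is_diff df /smooth_is_diff dg.
exact: (is_diff_dif v (is_diff_comp df dg)).
Qed.

Lemma smooth_linear m W (l : 'rV[R]_m -> W) x : linear l -> smooth_at l x.
Proof.
move=> hl; pose ll : {linear 'rV[R]_m -> W} := HB.pack l (GRing.isLinear.Build _ _ _ _ _ hl).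
exact: (smooth_at_linear ll (smooth_at_id x)).
Qed.

Lemma dif_of_linear m W (l : 'rV[R]_m -> W) x v : linear l -> dif l x v = l v.
Proof.
move=> hl; pose ll : {linear 'rV[R]_m -> W} := HB.pack l (GRing.isLinear.Build _ _ _ _ _ hl).
have cl : continuous ll by exact: continuous_linear_rV.
have D : is_diff x ll ll by split; [exact: linear_differentiable|exact: diff_lin].
exact: (is_diff_dif v D).
Qed.

Lemma smooth_linear_comp V m W (l : 'rV[R]_m -> W) (f : V -> 'rV[R]_m) x :
  linear l -> smooth_at f x -> smooth_at (fun z => l (f z)) x.
Proof. by move=> hl sf; exact: smooth_at_comp sf (smooth_linear _ hl). Qed.

Lemma dif_linear_comp V m W (l : 'rV[R]_m -> W) (f : V -> 'rV[R]_m) x v :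
  linear l -> smooth_at f x -> dif (fun z => l (f z)) x v = l (dif f x v).
Proof.
by move=> hl sf; rewrite dif_comp // ?dif_of_linear //; exact: smooth_linear.
Qed.

Lemma smooth_at_dif m W (f : 'rV[R]_m -> W) V (g u : V -> 'rV[R]_m) x :
  smooth_at g x -> smooth_at u x -> smooth_at f (g x) ->
  smooth_at (fun y => dif f (g y) (u y)) x.
Proof.
move=> sg su sf; under eq_fun do rewrite difE; exact: smooth_at_diff.
Qed.

Lemma smooth_at_difv m W (f : 'rV[R]_m -> W) x v :
  smooth_at f x -> smooth_at (fun y => dif f y v) x.
Proof. by move=> sf; apply: smooth_at_dif; [exact: smooth_at_id|exact: smooth_at_cst|]. Qed.

Lemma dif_schwarz_of_derive V W (f : V -> W) x u v : smooth_at f x ->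
  'D_v ('D_u f) x = 'D_u ('D_v f) x ->
  dif (fun z => dif f z u) x v = dif (fun z => dif f z v) x u.
Proof.
move=> sf S.
have H w : \near x, 'D_w f x = dif f x w.
  by apply: filterS (smooth_at_near sf) => y sy; rewrite dif_derive.
rewrite (near_eq_dif v (H u)); last exact: smooth_at_derive.
rewrite (near_eq_dif u (H v)); last exact: smooth_at_derive.
exact: etrans (dif_derive _ (smooth_at_derive u sf)) (etrans S (esym (dif_derive _ (smooth_at_derive v sf)))).
Qed.

Lemma dif_schwarz_real V (f : V -> R) x u v : smooth_at f x ->
  dif (fun z => dif f z u) x v = dif (fun z => dif f z v) x u.
Proof. move=> sf; exact: (dif_schwarz_of_derive sf (schwarz_real u v sf)). Qed.

Lemma dif_schwarz V m (f : V -> 'rV[R]_m) x u v : smooth_at f x ->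
  dif (fun z => dif f z u) x v = dif (fun z => dif f z v) x u.
Proof. move=> sf; exact: (dif_schwarz_of_derive sf (schwarz u v sf)). Qed.

Lemma row_mx0_linear m n : linear (fun w : 'rV[R]_n => row_mx (0 : 'rV[R]_m) w).
Proof. by move=> a u v; rewrite scale_row_mx add_row_mx scaler0 addr0. Qed.

Lemma row_mxr0_linear m n : linear (fun w : 'rV[R]_m => row_mx w (0 : 'rV[R]_n)).
Proof. by move=> a u v; rewrite scale_row_mx add_row_mx scaler0 addr0. Qed.

Lemma dif_row_mx m n V (f : V -> 'rV[R]_m) (g : V -> 'rV[R]_n) x v :
  smooth_at f x -> smooth_at g x ->
  dif (fun z => row_mx (f z) (g z)) x v = row_mx (dif f x v) (dif g x v).
Proof.
move=> sf sg.
have E z : row_mx (f z) (g z) = row_mx (f z) 0 + row_mx 0 (g z).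
  by rewrite add_row_mx addr0 add0r.
rewrite (eq_dif _ _ E) difD.
- rewrite (dif_linear_comp v (@row_mxr0_linear m n) sf).
  by rewrite (dif_linear_comp v (@row_mx0_linear m n) sg) add_row_mx addr0 add0r.
- exact: (smooth_linear_comp (@row_mxr0_linear m n) sf).
- exact: (smooth_linear_comp (@row_mx0_linear m n) sg).
Qed.

Lemma dif_partialr m n W (F : 'rV[R]_(m + n) -> W) x y v :
  smooth_at F (row_mx x y) ->
  dif (fun w => F (row_mx x w)) y v = dif F (row_mx x y) (row_mx 0 v).
Proof.
move=> sF.
have s1 : smooth_at (fun=> x : 'rV[R]_m) y by exact: smooth_at_cst.
have s2 : smooth_at (fun w => w) y by exact: smooth_at_id.
rewrite dif_comp //; last exact: smooth_at_row_mx.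
by rewrite dif_row_mx // dif_cst dif_id.
Qed.

Lemma dif_partiall m n W (F : 'rV[R]_(m + n) -> W) x y v :
  smooth_at F (row_mx x y) ->
  dif (fun w => F (row_mx w y)) x v = dif F (row_mx x y) (row_mx v 0).
Proof.
move=> sF.
have s1 : smooth_at (fun=> y : 'rV[R]_n) x by exact: smooth_at_cst.
have s2 : smooth_at (fun w => w) x by exact: smooth_at_id.
rewrite dif_comp //; last exact: smooth_at_row_mx.
by rewrite dif_row_mx // dif_cst dif_id.
Qed.

(** The function [F z] that is differentiated varies with the base point. Its differential at [c z]
    is that of the joint map in a direction with zero first component, so joint smoothness
    suffices. *)
Lemma smooth_at_partial m n W (F : 'rV[R]_m -> 'rV[R]_n -> W)
    (c u : 'rV[R]_m -> 'rV[R]_n) y :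
  smooth_at (fun p => F (lsubmx p) (rsubmx p)) (row_mx y (c y)) ->
  smooth_at c y -> smooth_at u y ->
  smooth_at (fun z => dif (F z) (c z) (u z)) y.
Proof.
set J := fun p => _; move=> sJ sc su.
have sr : smooth_at (fun z => row_mx z (c z)) y.
  by apply: smooth_at_row_mx => //; exact: smooth_at_id.
apply: (@smooth_at_ext _ _ (fun z => dif J (row_mx z (c z)) (row_mx 0 (u z)))).
  have H : \forall z \near y, smooth_at J (row_mx z (c z)) :=
    smooth_at_continuous sr (smooth_at_near sJ).
  apply: filterS H => z dJ.
  rewrite -dif_partialr //; apply: eq_dif => w.
  by rewrite /J row_mxKl row_mxKr.
apply: smooth_at_dif => //; apply: smooth_at_row_mx => //; exact: smooth_at_cst.
Qed.

Lemma linear_rV_expand m W (l : 'rV[R]_m -> W) v : linear l ->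
  l v = \sum_i v ord0 i *: l (delta_mx ord0 i).
Proof.
move=> hl; pose ll : {linear 'rV[R]_m -> W} := HB.pack l (GRing.isLinear.Build _ _ _ _ _ hl).
rewrite -[l v]/(ll v) {1}(row_sum_delta v) linear_sum.
by apply: eq_bigr => i _; rewrite linearZ.
Qed.

(** Expanding [u z] in the basis reduces the product rule to scalar multiples of the
    [L z (delta_mx ord0 i)]: smoothness of [L] is asked at fixed vectors only, and no topology on
    spaces of linear maps intervenes. *)
Lemma dif_linear_family V m W (L : V -> 'rV[R]_m -> W) (u : V -> 'rV[R]_m) (y w : V) :
  (forall z, linear (L z)) -> (forall v, smooth_at (L ^~ v) y) -> smooth_at u y ->
  dif (fun z => L z (u z)) y w = dif (L ^~ (u y)) y w + L y (dif u y w).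
Proof.
move=> linL sL su.
have LE z v : L z v = \sum_i v ord0 i *: L z (delta_mx ord0 i) by exact: linear_rV_expand.
have sui i : smooth_at (fun z => u z ord0 i) y by move/smooth_at_coord : su.
rewrite (eq_dif _ _ (fun z => LE z (u z))) dif_sum; last first.
  by move=> i; apply: smooth_atZ.
rewrite (eq_dif _ _ (fun z => LE z (u y))) dif_sum; last first.
  by move=> i; apply: smooth_atZ => //; exact: smooth_at_cst.
rewrite (LE y (dif u y w)) -big_split; apply: eq_bigr => i _.
rewrite difZ // difZ //; last exact: smooth_at_cst.
by rewrite dif_cst scale0r add0r addrC (dif_linear_comp w (@coordl_is_linear m i) su).
Qed.

Lemma smooth_linear_family V m W (L : V -> 'rV[R]_m -> W) (u : V -> 'rV[R]_m) (y : V) :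
  (forall z, linear (L z)) -> (forall v, smooth_at (L ^~ v) y) -> smooth_at u y ->
  smooth_at (fun z => L z (u z)) y.
Proof.
move=> linL sL su.
have LE z v : L z v = \sum_i v ord0 i *: L z (delta_mx ord0 i) by exact: linear_rV_expand.
have sui i : smooth_at (fun z => u z ord0 i) y by move/smooth_at_coord : su.
under eq_fun do rewrite LE.
by apply: smooth_at_sum => i _; apply: smooth_atZ.
Qed.

End Differentiation.

(** * Smooth manifolds *)

Section Plots.
Context {R : realType}.
Implicit Types V W : normedModType R.

Lemma near_open V (S P : set V) y : open S -> S y -> (forall z, S z -> P z) -> \near y, P y.
Proof. by move=> oS Sy SP; exact: filterS SP (open_nbhs_nbhs (conj oS Sy)). Qed.

(** Smoothness at [y] of a map into [M], tested in one chart. That [f] stays in the domain near [y]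
    is asked separately: [crd i] is a total function, and its smoothness along [f] does not tell
    where [f] goes. *)
Definition plot n (M : Type) (A : atlas R n M) V (f : V -> M) (y : V) : Prop :=
  exists i : chart A, (\near y, dom i (f y)) /\ smooth_at (crd i \o f) y.

Section OneManifold.
Context {n : nat} {M : Type} {A : atlas R n M}.
Hypothesis hA : smooth_manifold A.

Lemma crdK (i : chart A) x : dom i x -> par i (crd i x) = x.
Proof. by case: hA => _ + _ _ _; apply. Qed.

Lemma chart_atP x : dom (chart_at A x) x.
Proof. by case: hA. Qed.

Lemma open_overlap (i j : chart A) : open (crd i @` (dom i `&` dom j)).
Proof. by case: hA => _ _ /(_ i j) [+ _] _ _; apply. Qed.

Lemma open_chart (i : chart A) : open (crd i @` dom i).
Proof. by rewrite -[dom i]setIid; exact: open_overlap. Qed.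

Lemma smooth_transition (i j : chart A) x : dom i x -> dom j x ->
  smooth_at (crd j \o par i) (crd i x).
Proof.
move=> ix jx; case: hA => _ _ /(_ i j) [oij +] _ _.
by move=> /(smooth_onP _ oij); apply; exists x.
Qed.

Lemma near_par (i : chart A) x : dom i x ->
  \forall z \near crd i x, dom i (par i z) /\ crd i (par i z) = z.
Proof.
move=> ix; have S : (crd i @` dom i) (crd i x) by exists x.
apply: (near_open (@open_chart i) S) => z [w iw <-].
by rewrite crdK.
Qed.

Lemma near_par_overlap (i j : chart A) x : dom i x -> dom j x ->
  \forall z \near crd i x, dom j (par i z).
Proof.
move=> ix jx; have S : (crd i @` (dom i `&` dom j)) (crd i x) by exists x.
apply: (near_open (@open_overlap i j) S) => z [w [iw jw] <-].
by rewrite crdK.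
Qed.

(** The witnessing chart can be exchanged for any chart around [f y]: near [y], the new coordinates
    are the old ones followed by a smooth transition map. *)
Lemma plot_chart V (f : V -> M) y (j : chart A) : plot A f y -> dom j (f y) ->
  (\near y, dom j (f y)) /\ smooth_at (crd j \o f) y.
Proof.
move=> [i [ni si]] jy; have iy := nbhs_singleton ni.
have ci : \forall z \near y, dom j (par i (crd i (f z))) :=
  smooth_at_continuous si (near_par_overlap iy jy).
split; first by apply: filterS2 ni ci => z iz; rewrite crdK.
apply: (@smooth_at_ext _ _ _ (fun z => (crd j \o par i) (crd i (f z)))).
  by apply: filterS ni => z iz /=; rewrite crdK.
by apply: (smooth_at_comp si); exact: smooth_transition.
Qed.

Lemma plot_par (i : chart A) x : dom i x -> plot A (par i) (crd i x).
Proof.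
move=> ix; exists i; split; first by apply: filterS (near_par ix) => z [].
by apply: smooth_at_ext (smooth_at_id _); apply: filterS (near_par ix) => z [_ /= ->].
Qed.

Lemma smooth_funP (H : M -> R) :
  smooth_fun A H <-> forall (i : chart A) x, dom i x -> smooth_at (H \o par i) (crd i x).
Proof.
split=> h i; first by move=> x ix; apply: ((smooth_onP (H \o par i) (@open_chart i)).1 (h i)); exists x.
by apply/(smooth_onP _ (@open_chart i)) => _ [x ix <-]; exact: h.
Qed.

Lemma plot_cst V (x : M) (y : V) : plot A (fun=> x) y.
Proof.
exists (chart_at A x); split; last exact: smooth_at_cst.
by apply: nearW => z; exact: chart_atP.
Qed.

Lemma plot_comp V m (g : V -> 'rV[R]_m) (f : 'rV[R]_m -> M) y :
  smooth_at g y -> plot A f (g y) -> plot A (fun z => f (g z)) y.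
Proof.
move=> sg [i [ni si]]; exists i; split; last exact: smooth_at_comp sg si.
exact: (smooth_at_continuous sg ni).
Qed.

Lemma smooth_plot V W (f : V -> M) y (i : chart A) (F : M -> W) :
  plot A f y -> dom i (f y) -> smooth_at (F \o par i) (crd i (f y)) ->
  smooth_at (fun z => F (f z)) y.
Proof.
move=> pf iy sF; have [ni si] := plot_chart pf iy.
apply: (@smooth_at_ext _ _ _ (fun z => (F \o par i) (crd i (f z)))).
  by apply: filterS ni => z iz /=; rewrite crdK.
exact: smooth_at_comp si sF.
Qed.

Lemma dif_plot V W (f : V -> M) y (i : chart A) (F : M -> W) v :
  plot A f y -> dom i (f y) -> smooth_at (F \o par i) (crd i (f y)) ->
  dif (fun z => F (f z)) y v = dif (F \o par i) (crd i (f y)) (dif (crd i \o f) y v).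
Proof.
move=> pf iy sF; have [ni si] := plot_chart pf iy.
have E : \near y, (F \o par i) (crd i (f y)) = F (f y).
  by apply: filterS ni => z iz /=; rewrite crdK.
rewrite (near_eq_dif _ E); first by rewrite dif_comp.
exact: smooth_at_comp si sF.
Qed.

(** In another chart [j] the set is cut out by a condition on a transition map, whose continuity
    makes it open. Such coordinate balls serve to find a countable base of a product. *)
Lemma mopen_chart (i : chart A) (D : set 'rV[R]_n) : open D ->
  mopen A (dom i `&` crd i @^-1` D).
Proof.
move=> oD j; rewrite openE => _ [x [jx [ix Dx]] <-].
have c : \forall z \near crd j x, D (crd i (par j z)).
  apply: (smooth_at_continuous (smooth_transition jx ix)).
  apply: open_nbhs_nbhs; split=> //=; by rewrite crdK.
apply: filterS3 (near_par jx) (near_par_overlap jx ix) c => z [h1 h2] h3 h4.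
by exists (par j z).
Qed.

Lemma mopenT : mopen A setT.
Proof. by move=> i; rewrite setIT; exact: open_chart. Qed.

End OneManifold.

(** * Smooth maps, products of manifolds and vector spaces *)

Lemma smooth_map_plot m (M : Type) (A : atlas R m M) n (N : Type) (B : atlas R n N)
    (f : M -> N) V (g : V -> M) y :
  smooth_manifold A -> smooth_manifold B ->
  smooth_map A B f -> plot A g y -> plot B (fun z => f (g z)) y.
Proof.
move=> hA hB sf [i [ni si]]; have iy := nbhs_singleton ni.
set j := chart_at B (f (g y)); have jy : dom j (f (g y)) by exact: chart_atP.
have [oij sij] := sf i j.
have S : (crd i @` (dom i `&` f @^-1` dom j)) (crd i (g y)) by exists (g y).
exists j; split.
  have ci : \forall z \near y, (crd i @` (dom i `&` f @^-1` dom j)) (crd i (g z)).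
    exact: (smooth_at_continuous si (open_nbhs_nbhs (conj oij S))).
  apply: filterS2 ni ci => z iz [w [iw jw] e].
  by rewrite -(crdK hA iz) -e crdK.
apply: (@smooth_at_ext _ _ _ (fun z => (crd j \o f \o par i) (crd i (g z)))).
  by apply: filterS ni => z iz /=; rewrite crdK.
apply: (smooth_at_comp si).
exact: (smooth_onP _ oij).1.
Qed.

Lemma plot_pair m (M : Type) (A : atlas R m M) n (N : Type) (B : atlas R n N)
    V (f : V -> M) (g : V -> N) y :
  plot A f y -> plot B g y -> plot (prod_atlas A B) (fun z => (f z, g z)) y.
Proof.
move=> [i [ni si]] [j [nj sj]]; exists (i, j); split.
  by apply: filterS2 ni nj => z.
exact: smooth_at_row_mx.
Qed.

Lemma mopen_prod m (M : Type) (A : atlas R m M) n (N : Type) (B : atlas R n N)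
    (S : set M) (T : set N) :
  mopen A S -> mopen B T -> mopen (prod_atlas A B) (S `*` T).
Proof.
move=> hS hT [i j].
have -> : crd ((i, j) : chart (prod_atlas A B)) @` (dom ((i, j) : chart (prod_atlas A B)) `&` S `*` T) =
   lsubmx @^-1` (crd i @` (dom i `&` S)) `&` rsubmx @^-1` (crd j @` (dom j `&` T)).
  apply/seteqP; split=> [_ [x [[/= ix jx] [Sx Tx]] <-]|z [[x [ix Sx] e1] [y [jy Ty] e2]]] /=.
    by rewrite row_mxKl row_mxKr; split; [exists x.1|exists x.2].
  by exists (x, y) => //=; rewrite e1 e2 hsubmxK.
apply: openI; apply: open_comp.
- by move=> z _; exact: continuous_lsubmx.
- exact: hS.
- by move=> z _; exact: continuous_rsubmx.
- exact: hT.
Qed.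

Lemma prod_manifold m (M : Type) (A : atlas R m M) n (N : Type) (B : atlas R n N) :
  smooth_manifold A -> smooth_manifold B -> smooth_manifold (prod_atlas A B).
Proof.
move=> hA hB; split.
- by move=> x; split; exact: chart_atP.
- move=> [i j] [x y] [/= ix jy].
  by rewrite row_mxKl row_mxKr !crdK.
- move=> [i i'] [j j'].
  have o : open (crd ((i, i') : chart (prod_atlas A B)) @` (dom ((i, i') : chart (prod_atlas A B)) `&`
      dom ((j, j') : chart (prod_atlas A B)))).
    by apply: mopen_prod => k; exact: open_overlap.
  split=> //; apply/smooth_onP => // _ [[x y] [[/= ix iy] [/= jx jy]] <-].
  apply: smooth_at_row_mx.
    apply: (smooth_at_comp (f := lsubmx) (g := crd j \o par i)).
      exact: smooth_at_lsubmx (smooth_at_id _).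
    by rewrite row_mxKl; exact: (smooth_transition hA).
  apply: (smooth_at_comp (f := rsubmx) (g := crd j' \o par i')).
    exact: smooth_at_rsubmx (smooth_at_id _).
  by rewrite row_mxKr; exact: (smooth_transition hB).
- have [_ _ _ HA _] := hA; have [_ _ _ HB _] := hB.
  (* Distinct points differ in some factor; they are separated there, and the other factor is taken
     whole. *)
  move=> [x y] [x' y'] ne; have [ex|nx] := pselect (x = x').
    have ny : y <> y' by move=> ey; apply: ne; rewrite ex ey.
    have [S [T [oS oT Sy Ty ST]]] := HB _ _ ny.
    exists (setT `*` S), (setT `*` T); split=> //.
    + by apply: mopen_prod => //; exact: mopenT.
    + by apply: mopen_prod => //; exact: mopenT.
    + by apply/seteqP; split=> // -[a b] /= [[_ Sb] [_ Tb]]; have : (S `&` T) b by []; rewrite ST.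
  have [S [T [oS oT Sy Ty ST]]] := HA _ _ nx.
  exists (S `*` setT), (T `*` setT); split=> //.
  + by apply: mopen_prod => //; exact: mopenT.
  + by apply: mopen_prod => //; exact: mopenT.
  + by apply/seteqP; split=> // -[a b] /= [[Sa _] [Ta _]]; have : (S `&` T) a by []; rewrite ST.
- have [_ _ _ _ [BA [oBA hBA]]] := hA; have [_ _ _ _ [BB [oBB hBB]]] := hB.
  (* The base consists of products of basic sets, enumerated by the codes of pairs of indices;
     integers that code no pair get the empty set. *)
  exists (fun k => if unpickle k is Some p then BA p.1 `*` BB p.2 else set0); split.
    move=> k; case: unpickle => [[a b]|]; first exact: mopen_prod.
    by move=> i; rewrite setI0 image_set0; exact: open0.
  move=> S [x y] oS Sxy.
  set i := chart_at A x; set j := chart_at B y.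
  have [ix jy] : dom i x /\ dom j y by split; exact: chart_atP.
  pose T := crd ((i, j) : chart (prod_atlas A B)) @` (dom ((i, j) : chart (prod_atlas A B)) `&` S).
  have /nbhs_ballP [e /= e0 he] : nbhs (row_mx (crd i x) (crd j y)) T.
    by apply: open_nbhs_nbhs; split; [exact: oS|exists (x, y)].
  (* Balls of row vectors are entrywise, so a pair of points from the two coordinate balls of radius
     [e] lies in the ball of radius [e] around the coordinates of the pair. *)
  have oX : mopen A (dom i `&` crd i @^-1` (ball (crd i x) e)).
    by apply: mopen_chart => //; exact: ball_open.
  have oY : mopen B (dom j `&` crd j @^-1` (ball (crd j y) e)).
    by apply: mopen_chart => //; exact: ball_open.
  have [a Bx Ba] := hBA _ x oX (conj ix (ballxx _ e0)).
  have [b By Bb] := hBB _ y oY (conj jy (ballxx _ e0)).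
  exists (pickle (a, b)); first by rewrite pickleK.
  rewrite pickleK => -[x' y'] [/= /Ba [ix' bx] /Bb [jy' b_y]].
  have : T (row_mx (crd i x') (crd j y')).
    apply: he; split=> // k l; case: (splitP l) => l' ll.
      have -> : l = lshift n l' by exact: val_inj.
      by rewrite !row_mxEl; case: bx.
    have -> : l = rshift m l' by exact: val_inj.
    by rewrite !row_mxEr; case: b_y.
  move=> [[x'' y''] [/= [/= ix'' jy''] Sxy']] /eq_row_mx [e1 e2].
  by rewrite -(crdK hA ix') -(crdK hB jy') -e1 -e2 !crdK.
Qed.

Lemma vec_manifold n : smooth_manifold (vec_atlas n : atlas R n _).
Proof.
have idE (S : set 'rV[R]_n) : id @` S = S by exact: image_id.
split=> //.
- move=> i j; rewrite /= setTI idE; split; first exact: openT.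
  by apply/smooth_onP => [|x _]; [exact: openT|exact: smooth_at_id].
- move=> x y ne; have hT := @norm_hausdorff R 'rV[R]_n.
  rewrite open_hausdorff in hT; have /eqP ne' := ne.
  have [[S T] /= [Sx Ty] [oS oT /eqP ST]] := hT _ _ ne'; exists S, T; split=> //.
  + by move=> i; rewrite /= setTI idE.
  + by move=> i; rewrite /= setTI idE.
  + by move: Sx; rewrite inE.
  + by move: Ty; rewrite inE.
- pose B (p : 'rV[rat]_n * nat) := ball (map_mx (ratr : rat -> R) p.1) (p.2.+1%:R^-1 : R).
  exists (fun k => if unpickle k is Some p then B p else set0); split.
    move=> k i; rewrite /= setTI idE; case: unpickle => [p|]; last exact: open0.
    by apply: ball_open; rewrite invr_gt0.
  move=> S x oS Sx; have := oS tt; rewrite /= setTI idE => {}oS.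
  have /nbhs_ballP [e /= e0 he] := open_nbhs_nbhs (conj oS Sx).
  (* A ball of radius below e/2 that contains [x] lies in the ball of radius [e] around [x]. *)
  have [m hm] : exists m : nat, (m.+1%:R^-1 : R) < e / 2.
    have [m hm] := ltr_add_invr (divr_gt0 e0 (ltr0Sn R 1)).
    by exists m; rewrite add0r in hm.
  have m0 : 0 < (m.+1%:R^-1 : R) by rewrite invr_gt0.
  have hq (i : 'I_n) : exists q : rat, `|ratr q - x ord0 i| < (m.+1%:R^-1 : R).
    have xx : x ord0 i - m.+1%:R^-1 < x ord0 i + m.+1%:R^-1 by rewrite ltrD2l gtrN.
    have [q] := rat_in_itvoo xx.
    rewrite in_itv /= => /andP[q1 q2]; exists q.
    by rewrite ltr_distl q1 q2.
  have [q {}hq] := choice hq.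
  have Bx : B (\row_i q i, m) x.
    by split=> // k l; rewrite ord1 !mxE -ball_normE; exact: hq.
  exists (pickle (\row_i q i, m)); rewrite pickleK //.
  move=> y By; apply: he.
  apply: (@le_ball _ _ _ (m.+1%:R^-1 + m.+1%:R^-1)).
    by rewrite (splitr e) lerD // ltW.
  by apply: ball_triangle By; exact: ball_sym.
Qed.

End Plots.

(** * Lie groups *)

Section Lie.
Context {R : realType} {n : nat} {G : groupType} {A : atlas R n G}.
Implicit Types V W : normedModType R.
Hypothesis hG : lie_group A.
Local Notation E := (chart_at A 1%g).
Local Notation e0 := (crd E 1%g).

Lemma lie_manifold : smooth_manifold A. Proof. by case: hG. Qed.
Local Notation hA := lie_manifold.

Lemma dom1 : dom E 1%g. Proof. exact: (chart_atP hA). Qed.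

Lemma par1 : par E e0 = 1%g. Proof. exact: (crdK hA dom1). Qed.

Lemma plotM V (f g : V -> G) (y : V) :
  plot A f y -> plot A g y -> plot A (fun z => f z * g z)%g y.
Proof.
move=> pf pg; have [_ sm _] := hG.
exact: (smooth_map_plot (prod_manifold hA hA) hA sm (plot_pair pf pg)).
Qed.

Lemma plotV V (f : V -> G) (y : V) : plot A f y -> plot A (fun z => (f z)^-1%g) y.
Proof. by move=> pf; have [_ _ si] := hG; exact: (smooth_map_plot hA hA si pf). Qed.

Lemma plotE : plot A (par E) e0. Proof. exact: (plot_par hA dom1). Qed.

Lemma plotEM g : plot A (fun z => par E z * g)%g e0.
Proof. by apply: plotM; [exact: plotE|exact: (plot_cst hA)]. Qed.

Lemma plotJ g : plot A (fun z => g * par E z * g^-1)%g e0.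
Proof.
apply: plotM; last exact: (plot_cst hA).
by apply: plotM; [exact: (plot_cst hA)|exact: plotE].
Qed.

(* [rvec i g a] is T_e R_g a read in the chart i, that is, the value at g of the
   right-invariant vector field generated by a. *)
Definition rvec (i : chart A) (g : G) (a : 'rV[R]_n) : 'rV[R]_n :=
  dif (fun z => crd i (par E z * g)%g) e0 a.

(** [Ad g] with the target chart fixed to that of the identity; in [tmap] it is the chart at
    [g * 1 * g^-1], the same one only after rewriting. *)
Definition adj (g : G) (a : 'rV[R]_n) : 'rV[R]_n :=
  dif (fun z => crd E (g * par E z * g^-1)%g) e0 a.

Definition brk (a b : 'rV[R]_n) : 'rV[R]_n := dif (fun q => adj (par E q) b) e0 a.

Lemma AdE g a : Ad A g a = adj g a.
Proof. by rewrite /Ad /adj /tmap mulg1 mulgV difE. Qed.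

Lemma bracketE a b : bracket A a b = brk a b.
Proof.
rewrite /bracket /brk (_ : (fun g => Ad A g b) = fun g => adj g b).
  by rewrite difE.
by apply/funext => g; exact: AdE.
Qed.

Lemma tmap_mulr g a : tmap A A (fun h => h * g)%g 1%g a = rvec (chart_at A g) g a.
Proof. by rewrite /tmap /rvec difE mul1g. Qed.

Lemma rvec_linear i g : linear (rvec i g).
Proof. exact: dif_linear. Qed.

Lemma adj_linear g : linear (adj g).
Proof. exact: dif_linear. Qed.

Lemma brk_linearl b : linear (brk ^~ b).
Proof. exact: dif_linear. Qed.

Lemma smooth_rvec W (F : G -> W) (i : chart A) (g : G) : dom i g ->
  smooth_at (F \o par i) (crd i g) -> smooth_at (fun z => F (par E z * g)%g) e0.
Proof.
move=> ig sF; apply: (smooth_plot hA (i := i) (plotEM g));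
  by rewrite par1 mul1g.
Qed.

Lemma dif_rvec W (F : G -> W) (i : chart A) (g : G) a : dom i g ->
  smooth_at (F \o par i) (crd i g) ->
  dif (fun z => F (par E z * g)%g) e0 a = dif (F \o par i) (crd i g) (rvec i g a).
Proof.
move=> ig sF; have := @dif_plot _ _ _ _ hA _ _ _ e0 i F a (plotEM g).
by rewrite par1 mul1g => /(_ ig sF).
Qed.

Lemma dif_adj W (F : G -> W) (g : G) a : smooth_at (F \o par E) e0 ->
  dif (fun z => F (g * par E z * g^-1)%g) e0 a = dif (F \o par E) e0 (adj g a).
Proof.
move=> sF; have := @dif_plot _ _ _ _ hA _ _ _ e0 E F a (plotJ g).
by rewrite par1 mulg1 mulgV => /(_ dom1 sF).
Qed.

Lemma smooth_crd V (f : V -> G) y (i : chart A) : plot A f y -> dom i (f y) ->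
  smooth_at (fun z => crd i (f z)) y.
Proof. by move=> pf iy; exact: (plot_chart hA pf iy).2. Qed.

(** The product [par E w * f z] is smooth in [w] and [z] jointly, and [rvec] is its partial
    differential in [w] at the identity. *)
Lemma smooth_at_rvec m (f : 'rV[R]_m -> G) (u : 'rV[R]_m -> 'rV[R]_n) (y : 'rV[R]_m) i :
  plot A f y -> smooth_at u y -> dom i (f y) ->
  smooth_at (fun z => rvec i (f z) (u z)) y.
Proof.
move=> pf su iy.
apply: (@smooth_at_partial _ _ _ _ (fun z w => crd i (par E w * f z)%g) (fun=> e0)) => //; last exact: smooth_at_cst.
apply: smooth_crd; last by rewrite row_mxKl row_mxKr par1 mul1g.
apply: plotM.
  by apply: plot_comp; [exact: smooth_at_rsubmx (smooth_at_id _)|rewrite row_mxKr; exact: plotE].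
by apply: plot_comp; [exact: smooth_at_lsubmx (smooth_at_id _)|rewrite row_mxKl].
Qed.

Lemma smooth_at_adj m (f : 'rV[R]_m -> G) (u : 'rV[R]_m -> 'rV[R]_n) (y : 'rV[R]_m) :
  plot A f y -> smooth_at u y -> smooth_at (fun z => adj (f z) (u z)) y.
Proof.
move=> pf su.
apply: (@smooth_at_partial _ _ _ _ (fun z w => crd E (f z * par E w * (f z)^-1)%g) (fun=> e0)) => //; last exact: smooth_at_cst.
apply: smooth_crd; last by rewrite row_mxKl row_mxKr par1 mulg1 mulgV; exact: dom1.
have pl : plot A (fun p => f (lsubmx p)) (row_mx y e0).
  by apply: plot_comp; [exact: smooth_at_lsubmx (smooth_at_id _)|rewrite row_mxKl].
apply: plotM; last exact: plotV.
apply: plotM => //.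
by apply: plot_comp; [exact: smooth_at_rsubmx (smooth_at_id _)|rewrite row_mxKr; exact: plotE].
Qed.

Lemma adjM g h a : adj (g * h)%g a = adj g (adj h a).
Proof.
have s : smooth_at ((fun w => crd E (g * w * g^-1)%g) \o par E) e0.
  by apply: smooth_crd; [exact: plotJ|rewrite par1 mulg1 mulgV; exact: dom1].
apply: etrans (dif_adj h a s).
by apply: eq_dif => z; rewrite invgM !mulgA.
Qed.

Lemma dif_crdE a : dif (fun z => crd E (par E z)) e0 a = a.
Proof.
have nE : \forall z \near e0, id z = crd E (par E z).
  by apply: filterS (near_par hA dom1) => z [_ ->].
by rewrite (near_eq_dif _ nE) ?dif_id //; exact: smooth_at_id.
Qed.

Lemma adj1 a : adj 1%g a = a.
Proof.
apply: etrans (dif_crdE a).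
by apply: eq_dif => z; rewrite mul1g invg1 mulg1.
Qed.

Lemma adjKV g a : adj g (adj g^-1%g a) = a.
Proof. by rewrite -adjM mulgV adj1. Qed.

Lemma smooth_adj_par b : smooth_at (fun q => adj (par E q) b) e0.
Proof. by apply: smooth_at_adj; [exact: plotE|exact: smooth_at_cst]. Qed.

Lemma brk_linearr a : linear (brk a).
Proof.
move=> k u v; rewrite /brk.
rewrite (eq_dif _ _ (fun q => adj_linear (par E q) k u v)).
have s1 : smooth_at (fun=> k : R) e0 by exact: smooth_at_cst.
have su := smooth_adj_par u.
rewrite difD; [|exact: smooth_atZ|exact: smooth_adj_par].
by rewrite difZ // dif_cst scale0r add0r.
Qed.

(** By y z g = (y z y^-1) (y g), a left translation by [y] enters a right-invariant field through
    [adj y]. *)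
Lemma rvec_mul_adj (i : chart A) g y b : dom i (y * g)%g ->
  dif (fun z => crd i (y * par E z * g)%g) e0 b = rvec i (y * g)%g (adj y b).
Proof.
move=> iyg.
have s : smooth_at ((fun w => crd i (w * (y * g))%g) \o par E) e0.
  by apply: smooth_crd; [exact: plotEM|rewrite par1 mul1g].
apply: etrans (dif_adj y b s).
by apply: eq_dif => z; rewrite !mulgA mulgVK.
Qed.

Lemma smooth_rvec_par (i : chart A) g c : dom i g ->
  smooth_at ((fun h => rvec i h c) \o par i) (crd i g).
Proof.
move=> ig; apply: smooth_at_rvec; last by rewrite (crdK hA ig).
  exact: (plot_par hA ig).
exact: smooth_at_cst.
Qed.

(* Both sides differentiate [y, z |-> y z g = (y z y^-1) (y g)], once in each
   variable, in the two possible orders. *)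
Lemma rvec_commutator (i : chart A) g a b : dom i g ->
  dif (fun q => rvec i (par i q) a) (crd i g) (rvec i g b) -
  dif (fun q => rvec i (par i q) b) (crd i g) (rvec i g a) = rvec i g (brk a b).
Proof.
move=> ig; set x := crd i g.
pose N (p : 'rV[R]_(n + n)) := crd i (par E (lsubmx p) * par E (rsubmx p) * g)%g.
pose p0 : 'rV[R]_(n + n) := row_mx e0 e0.
have lE (f : 'rV[R]_(n + n) -> 'rV[R]_n) : smooth_at f p0 -> f p0 = e0 ->
    plot A (fun p => par E (f p)) p0.
  by move=> sf fe; apply: plot_comp => //; rewrite fe; exact: plotE.
have pN : plot A (fun p => par E (lsubmx p) * par E (rsubmx p) * g)%g p0.
  apply: plotM; last exact: (plot_cst hA).
  apply: plotM; apply: lE; rewrite /p0 ?row_mxKl ?row_mxKr //.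
    exact: smooth_at_lsubmx (smooth_at_id _).
  exact: smooth_at_rsubmx (smooth_at_id _).
have sN : smooth_at N p0.
  by apply: (smooth_crd pN); rewrite row_mxKl row_mxKr par1 !mul1g.
have nr : \forall z \near e0, smooth_at N (row_mx e0 z).
  have sr : smooth_at (fun z => row_mx e0 z) e0.
    by apply: smooth_at_row_mx; [exact: smooth_at_cst|exact: smooth_at_id].
  exact: (smooth_at_continuous sr (smooth_at_near sN)).
have nl : \forall z \near e0, smooth_at N (row_mx z e0).
  have sr : smooth_at (fun z => row_mx z e0) e0.
    by apply: smooth_at_row_mx; [exact: smooth_at_id|exact: smooth_at_cst].
  exact: (smooth_at_continuous sr (smooth_at_near sN)).
have Dl : \forall z \near e0, rvec i (par E z * g)%g a = dif N (row_mx e0 z) (row_mx a 0).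
  apply: filterS nr => z sz; rewrite -dif_partiall //; apply: eq_dif => w.
  by rewrite /N row_mxKl row_mxKr mulgA.
have iE : dom i (par E e0 * g)%g by rewrite par1 mul1g.
have Dr : \forall z \near e0, rvec i (par E z * g)%g (adj (par E z) b) =
    dif N (row_mx z e0) (row_mx 0 b).
  apply: filterS2 nl (plot_chart hA (plotEM g) iE).1 => z sz iz.
  rewrite -dif_partialr // -rvec_mul_adj //; apply: eq_dif => w.
  by rewrite /N row_mxKl row_mxKr.
have srv c : smooth_at (fun z => rvec i (par E z * g)%g c) e0.
  exact: (smooth_rvec ig (smooth_rvec_par c ig)).
have S := dif_schwarz (row_mx a 0) (row_mx 0 b) sN.
have L1 : dif (fun p => dif N p (row_mx a 0)) p0 (row_mx 0 b) =
    dif (fun q => rvec i (par i q) a) x (rvec i g b).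
  rewrite -dif_partialr; last exact: smooth_at_difv.
  rewrite (near_eq_dif _ Dl) //.
  exact: (dif_rvec b ig (smooth_rvec_par a ig)).
(* The outer derivative is in the first variable, on which both the point [par E z * g] and the
   vector [adj (par E z) b] depend: the point gives the derivative of the field, the vector gives
   the bracket. *)
have L2 : dif (fun p => dif N p (row_mx 0 b)) p0 (row_mx a 0) =
    dif (fun q => rvec i (par i q) b) x (rvec i g a) + rvec i g (brk a b).
  have lr z : linear (fun v => rvec i (par E z * g)%g v) by exact: rvec_linear.
  rewrite -dif_partiall; last exact: smooth_at_difv.
  rewrite (near_eq_dif _ Dr); last first.
    exact: (smooth_linear_family lr srv (smooth_adj_par b)).
  rewrite (dif_linear_family a lr srv (smooth_adj_par b)) par1 mul1g adj1.
  congr (_ + _).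
  exact: (dif_rvec a ig (smooth_rvec_par b ig)).
by apply/eqP; rewrite subr_eq addrC; apply/eqP; rewrite -L1 -L2.
Qed.

(** * Antisymmetry, invariance and Jacobi identity of the Lie bracket *)

Lemma rvec1 a : rvec E 1%g a = a.
Proof.
apply: etrans (dif_crdE a).
by apply: eq_dif => z; rewrite mulg1.
Qed.

(** At the identity of the group [rvec] is the identity map, so [rvec_commutator] writes the bracket
    as a commutator, which changes sign when its arguments are exchanged. *)
Lemma brkC a b : brk a b = - brk b a.
Proof.
have h1 := rvec_commutator a b dom1; have h2 := rvec_commutator b a dom1.
by rewrite !rvec1 in h1 h2; rewrite -h1 -h2 opprB.
Qed.

(** Ad_g Ad_q b = Ad_(g q g^-1) Ad_g b; differentiating at q = 1 in the direction [a] produces a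
    bracket on each side. *)
Lemma adj_brk g a b : adj g (brk a b) = brk (adj g a) (adj g b).
Proof.
rewrite [in RHS]/brk.
have h := dif_adj g a (smooth_adj_par (adj g b) : smooth_at ((fun w => adj w (adj g b)) \o par E) e0).
apply: etrans h.
rewrite -(dif_linear_comp a (adj_linear g) (smooth_adj_par b)).
by apply: eq_dif => z; rewrite -!adjM mulgVK.
Qed.

(** This is the derivative of [adj_brk] at the identity in the direction [c], by the product rule on
    the right-hand side. *)
Lemma brk_jacobi c a b :
  brk c (brk a b) = brk (brk c a) b + brk a (brk c b).
Proof.
rewrite {1}/brk (eq_dif _ _ (fun q => adj_brk (par E q) a b)).
have sl v : smooth_at (fun z => brk (adj (par E z) a) v) e0.
  exact: (smooth_linear_comp (brk_linearl v) (smooth_adj_par a)).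
rewrite (dif_linear_family c (fun z => brk_linearr (adj (par E z) a)) sl (smooth_adj_par b)).
by rewrite (dif_linear_comp c (brk_linearl _) (smooth_adj_par a)) par1 !adj1.
Qed.

(* T_g R_(g^-1), on tangent vectors read in the chart i. *)
Definition rinv (i : chart A) (g : G) (v : 'rV[R]_n) : 'rV[R]_n :=
  dif (fun q => crd E (par i q * g^-1)%g) (crd i g) v.

Lemma rinv_linear i g : linear (rinv i g).
Proof. exact: dif_linear. Qed.

Lemma plot_rinv (i : chart A) g : dom i g -> plot A (fun q => par i q * g^-1)%g (crd i g).
Proof. by move=> ig; apply: plotM; [exact: (plot_par hA ig)|exact: (plot_cst hA)]. Qed.

Lemma rvecK i g : dom i g -> cancel (rvec i g) (rinv i g).
Proof.
move=> ig a.
have s : smooth_at ((fun w => crd E (w * g^-1)%g) \o par i) (crd i g).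
  apply: (smooth_crd (plot_rinv ig)).
  by rewrite (crdK hA ig) mulgV; exact: dom1.
apply: etrans (esym (dif_rvec a ig s)) _; apply: etrans (dif_crdE a).
by apply: eq_dif => z; rewrite mulgK.
Qed.

Lemma rinvK i g : dom i g -> cancel (rinv i g) (rvec i g).
Proof.
move=> ig v.
have ge : (par i (crd i g) * g^-1)%g = 1%g by rewrite (crdK hA ig) mulgV.
have s : smooth_at ((fun w => crd i (w * g)%g) \o par E) (crd E (par i (crd i g) * g^-1)%g).
  rewrite ge; apply: (smooth_crd (plotEM g)).
  by rewrite par1 mul1g.
have dE : dom E (par i (crd i g) * g^-1)%g by rewrite ge; exact: dom1.
have := @dif_plot _ _ _ _ hA _ _ _ _ E _ v (plot_rinv ig) dE s.
rewrite ge => h; apply: etrans (esym h) _.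
have nE : \forall z \near crd i g, id z = crd i (par i z * g^-1 * g)%g.
  by apply: filterS (near_par hA ig) => z [_ e] /=; rewrite mulgVK e.
by rewrite (near_eq_dif _ nE) ?dif_id //; exact: smooth_at_id.
Qed.

(** The point [crd i (f z)] at which the differential is taken moves with [z] too, whence the
    variable base point [c] in [smooth_at_partial]. *)
Lemma smooth_at_rinv m (f : 'rV[R]_m -> G) (u : 'rV[R]_m -> 'rV[R]_n) (y : 'rV[R]_m) i :
  plot A f y -> smooth_at u y -> dom i (f y) ->
  smooth_at (fun z => rinv i (f z) (u z)) y.
Proof.
move=> pf su iy.
apply: (@smooth_at_partial _ _ _ _ (fun z w => crd E (par i w * (f z)^-1)%g) (fun z => crd i (f z))) => //.
  apply: smooth_crd; last by rewrite row_mxKl row_mxKr (crdK hA iy) mulgV; exact: dom1.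
  apply: plotM.
    by apply: plot_comp; [exact: smooth_at_rsubmx (smooth_at_id _)|rewrite row_mxKr; exact: (plot_par hA iy)].
  apply: plotV.
  by apply: plot_comp; [exact: smooth_at_lsubmx (smooth_at_id _)|rewrite row_mxKl].
exact: smooth_crd.
Qed.

(** The chain rule at t = 0 for q |-> Ad_q eta along [gam]; the curve stays near 0 in the domain of
    the chart, where [par] inverts [crd]. *)
Lemma bracket_one_parameter xi eta (gam : R -> G) :
  one_parameter_subgroup A xi gam ->
  is_derive (0 : R) (1 : R) (fun t => Ad A (gam t) eta) (bracket A xi eta).
Proof.
move=> [gM gd [gder gval]].
(* [gam 0] is idempotent, hence trivial in a group. *)
have g0 : gam 0 = 1%g.
  by apply: (mulgI (gam 0)); rewrite mulg1 -gM addr0.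
have gdiff : differentiable (crd E \o gam) (0 : R) by apply/derivable1_diffP.
have sAd : is_diff ((crd E \o gam) 0) (fun q => adj (par E q) eta)
    (dif (fun q => adj (par E q) eta) e0).
  by rewrite /= g0; exact: smooth_is_diff (smooth_adj_par eta).
have D := is_diff_comp (differentiableP gdiff) sAd.
apply: (@near_eq_is_derive _ _ _ ((fun q => adj (par E q) eta) \o (crd E \o gam))).
  by apply: filterS gd => t /= gt; rewrite (crdK hA gt) AdE.
split; first by apply: diff_derivable; exact: ex_diff.
rewrite deriveE; last exact: ex_diff.
have /(congr1 (@^~ 1)) := @diff_val _ _ _ _ _ _ _ D; rewrite /= => ->.
by rewrite -(deriveE _ gdiff) gval bracketE.
Qed.

End Lie.

(** * The canonical bracket *)

Section Pairing.
Context {R : realType}.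
Implicit Types V W : normedModType R.

Lemma pairing_linearr n (mu : 'rV[R]_n) : linear (pairing mu).
Proof.
move=> a u v; rewrite /pairing scaler_sumr -big_split; apply: eq_bigr => k _.
by rewrite /= !mxE /GRing.scale /=; ring.
Qed.

Lemma pairing_linearl n (xi : 'rV[R]_n) : linear (fun mu : 'rV[R]_n => pairing mu xi).
Proof.
move=> a u v; rewrite /pairing scaler_sumr -big_split; apply: eq_bigr => k _.
by rewrite /= !mxE /GRing.scale /=; ring.
Qed.

Lemma pairingC n (mu xi : 'rV[R]_n) : pairing mu xi = pairing xi mu.
Proof. by apply: eq_bigr => k _; rewrite mulrC. Qed.

Lemma pairingDr n (mu u v : 'rV[R]_n) : pairing mu (u + v) = pairing mu u + pairing mu v.
Proof. by have := pairing_linearr mu 1 u v; rewrite !scale1r. Qed.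

Lemma pairingZr n (mu u : 'rV[R]_n) a : pairing mu (a *: u) = a * pairing mu u.
Proof. by rewrite /pairing mulr_sumr; apply: eq_bigr => k _; rewrite mxE; ring. Qed.

Lemma pairingNr n (mu u : 'rV[R]_n) : pairing mu (- u) = - pairing mu u.
Proof. by rewrite -scaleN1r pairingZr mulN1r. Qed.

Lemma pairingBr n (mu u v : 'rV[R]_n) : pairing mu (u - v) = pairing mu u - pairing mu v.
Proof. by rewrite pairingDr pairingNr. Qed.

Lemma pairingBl n (mu u v : 'rV[R]_n) : pairing (u - v) mu = pairing u mu - pairing v mu.
Proof. by rewrite !(pairingC _ mu) pairingBr. Qed.

Lemma pairing0l n (mu : 'rV[R]_n) : pairing 0 mu = 0.
Proof. by rewrite /pairing big1 // => k _; rewrite mxE mul0r. Qed.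

Lemma pairing0r n (mu : 'rV[R]_n) : pairing mu 0 = 0.
Proof. by rewrite pairingC pairing0l. Qed.

Lemma pairing_delta n (mu : 'rV[R]_n) k : pairing mu (delta_mx ord0 k) = mu ord0 k.
Proof.
rewrite /pairing (bigD1 k) //= big1 ?addr0 ?mxE ?eqxx ?mulr1 // => l lk.
by rewrite mxE eqxx (negbTE lk) mulr0.
Qed.

Lemma pairing_ext n (mu nu : 'rV[R]_n) : (forall xi, pairing mu xi = pairing nu xi) -> mu = nu.
Proof. by move=> h; apply/rowP => k; rewrite -!pairing_delta h. Qed.

Lemma pairing_dual_repr n (f : 'rV[R]_n -> R) v : linear f -> pairing (dual_repr f) v = f v.
Proof.
move=> lf; rewrite (linear_rV_expand v lf); apply: eq_bigr => k _.
by rewrite mxE mulrC.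
Qed.

Lemma pairing_row m n (a c : 'rV[R]_m) (b d : 'rV[R]_n) :
  pairing (row_mx a b) (row_mx c d) = pairing a c + pairing b d.
Proof.
rewrite /pairing big_split_ord; congr (_ + _); apply: eq_bigr => k _.
  by rewrite !row_mxEl.
by rewrite !row_mxEr.
Qed.

Lemma smooth_pairing n V (f g : V -> 'rV[R]_n) y :
  smooth_at f y -> smooth_at g y -> smooth_at (fun z => pairing (f z) (g z)) y.
Proof.
move=> /smooth_at_coord sf /smooth_at_coord sg.
by apply: smooth_at_sum => k _; exact: smooth_atM.
Qed.

Lemma dif_pairing n V (f g : V -> 'rV[R]_n) y v :
  smooth_at f y -> smooth_at g y ->
  dif (fun z => pairing (f z) (g z)) y v = pairing (dif f y v) (g y) + pairing (f y) (dif g y v).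
Proof.
move=> sf sg.
rewrite (@dif_linear_family _ _ _ _ (fun z w => pairing (f z) w)) //.
- by rewrite (dif_linear_comp v (pairing_linearl (g y)) sf).
- by move=> z; exact: pairing_linearr.
- by move=> w; exact: (smooth_linear_comp (pairing_linearl w) sf).
Qed.

End Pairing.

Section Canonical.
Context {R : realType} {N : nat}.
Local Notation Z := 'rV[R]_(N + N).
Implicit Types F G L : Z -> R.

Local Notation e k := (row_mx (delta_mx ord0 k) 0 : Z).
Local Notation f k := (row_mx 0 (delta_mx ord0 k) : Z).

(* The canonical bracket in the coordinates (q, p) of T^*R^N. *)
Definition canbr F G (y : Z) : R :=
  \sum_k (dif F y (e k) * dif G y (f k) - dif F y (f k) * dif G y (e k)).

(** Exchanging the summations shows that twice the sum vanishes. *)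
Lemma sum_antisym (T : 'I_N -> 'I_N -> R) : (forall k l, T k l + T l k = 0) ->
  \sum_l \sum_k T k l = 0.
Proof.
move=> h; set S := \sum_l _.
suff : S *+ 2 == 0 by rewrite mulrn_eq0 => /eqP.
rewrite mulr2n /S; apply/eqP; rewrite [X in X + _]exchange_big -big_split big1 //= => k _.
by rewrite -big_split big1 // => l _; exact: h.
Qed.

Lemma smooth_canbr F G y : smooth_at F y -> smooth_at G y -> smooth_at (canbr F G) y.
Proof.
move=> sF sG; apply: smooth_at_sum => k _.
by apply: smooth_atB; apply: smooth_atM; exact: smooth_at_difv.
Qed.

Lemma dif_canbr F G y v : smooth_at F y -> smooth_at G y ->
  dif (canbr F G) y v = \sum_k
    (dif (fun z => dif F z (e k)) y v * dif G y (f k) + dif F y (e k) * dif (fun z => dif G z (f k)) y v -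
    (dif (fun z => dif F z (f k)) y v * dif G y (e k) + dif F y (f k) * dif (fun z => dif G z (e k)) y v)).
Proof.
move=> sF sG; have sFv w := smooth_at_difv w sF; have sGv w := smooth_at_difv w sG.
rewrite dif_sum => [|k]; last by apply: smooth_atB; apply: smooth_atM.
apply: eq_bigr => k _; rewrite difB; [|exact: smooth_atM|exact: smooth_atM].
by rewrite !difM.
Qed.

(** After expansion, the summand at (k, l) is opposite to the one at (l, k) by the symmetry of
    second derivatives. *)
Lemma canbr_jacobi F G L y : smooth_at F y -> smooth_at G y -> smooth_at L y ->
  canbr (canbr F G) L y + canbr (canbr G L) F y + canbr (canbr L F) G y = 0.
Proof.
move=> sF sG sL; rewrite /canbr -!big_split /=.
under eq_bigr => l _.
  rewrite !dif_canbr // !mulr_suml -!sumrN -!big_split /=.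
  over.
apply: sum_antisym => k l.
have S K (sK : smooth_at K y) u v := dif_schwarz_real u v sK.
(* Each mixed derivative is brought to one of its two forms, which turns the cancellation into a
   polynomial identity. *)
rewrite (S F sF (e l) (e k)) (S F sF (f l) (f k)) (S F sF (f k) (e l)) (S F sF (f l) (e k)).
rewrite (S G sG (e l) (e k)) (S G sG (f l) (f k)) (S G sG (f k) (e l)) (S G sG (f l) (e k)).
rewrite (S L sL (e l) (e k)) (S L sL (f l) (f k)) (S L sL (f k) (e l)) (S L sL (f l) (e k)).
ring.
Qed.

End Canonical.

(** * The reduced bracket in coordinates *)

Section LiePoisson.
Context {R : realType} {n : nat} {G : groupType} {A : atlas R n G}.
Implicit Types V W : normedModType R.
Hypothesis hG : lie_group A.
Local Notation hA := (lie_manifold hG).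
Local Notation E := (chart_at A 1%g).
Local Notation e0 := (crd E 1%g).
Local Notation P := (G * ('rV[R]_n * 'rV[R]_n))%type.
Local Notation Y := 'rV[R]_(n + (n + n)).
Local Notation rvec := (@rvec R n G A).
Local Notation brk := (@brk R n G A).

Lemma bracket_brk : bracket A = brk.
Proof. by apply/funext => a; apply/funext => b; exact: bracketE. Qed.

Lemma brkDr a b c : brk a (b + c) = brk a b + brk a c.
Proof. by have := brk_linearr hG a 1 b c; rewrite !scale1r. Qed.

Lemma brkNr a b : brk a (- b) = - brk a b.
Proof.
have h0 : brk a 0 = 0 by have := brk_linearr hG a (-1) 0 0; rewrite scaleN1r scaleN1r oppr0 addr0 addNr.
by have := brk_linearr hG a (-1) b 0; rewrite h0 !scaleN1r !addr0.
Qed.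

Lemma brkBr a b c : brk a (b - c) = brk a b - brk a c.
Proof. by rewrite brkDr brkNr. Qed.

Lemma brkNl a b : brk (- a) b = - brk a b.
Proof. by rewrite (brkC hG (- a) b) brkNr (brkC hG a b). Qed.

Lemma brkDl a b c : brk (a + b) c = brk a c + brk b c.
Proof. by rewrite (brkC hG) brkDr opprD -!(brkC hG). Qed.

Lemma smooth_brk V (u v : V -> 'rV[R]_n) y : smooth_at u y -> smooth_at v y ->
  smooth_at (fun z => brk (u z) (v z)) y.
Proof.
move=> su sv; apply: (@smooth_linear_family _ _ _ _ (fun z w => brk (u z) w)) => //.
  by move=> z; exact: brk_linearr.
by move=> w; exact: (smooth_linear_comp (brk_linearl w) su).
Qed.

(* The partial derivatives delta h / delta mu and delta h / delta nu of a
   function of the coordinates (q, mu, nu). *)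
Definition gmu (h : Y -> R) (y : Y) : 'rV[R]_n :=
  \row_k dif h y (row_mx 0 (row_mx (delta_mx ord0 k) 0)).
Definition gnu (h : Y -> R) (y : Y) : 'rV[R]_n :=
  \row_k dif h y (row_mx 0 (row_mx 0 (delta_mx ord0 k))).

Lemma pairing_gmu h y a : pairing (gmu h y) a = dif h y (row_mx 0 (row_mx a 0)).
Proof.
rewrite -(pairing_dual_repr (f := fun a => dif h y (row_mx 0 (row_mx a 0)))) //.
move=> k u v; rewrite -dif_linear; congr (dif _ _ _).
by rewrite scale_row_mx add_row_mx scale_row_mx add_row_mx !scaler0 !addr0.
Qed.

Lemma pairing_gnu h y a : pairing (gnu h y) a = dif h y (row_mx 0 (row_mx 0 a)).
Proof.
rewrite -(pairing_dual_repr (f := fun a => dif h y (row_mx 0 (row_mx 0 a)))) //.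
move=> k u v; rewrite -dif_linear; congr (dif _ _ _).
by rewrite scale_row_mx add_row_mx scale_row_mx add_row_mx !scaler0 !addr0.
Qed.

Lemma dif_split h y u M N : dif h y (row_mx u (row_mx M N)) =
  dif h y (row_mx u 0) + pairing (gmu h y) M + pairing (gnu h y) N.
Proof.
rewrite pairing_gmu pairing_gnu -!linearD; congr (dif _ _ _).
by rewrite -[(0 : 'rV[R]_(n + n))]row_mx0 !add_row_mx !addr0 !add0r.
Qed.

Lemma smooth_gmu h y : smooth_at h y -> smooth_at (gmu h) y.
Proof.
move=> sh; apply/smooth_at_coord => k; under eq_fun do rewrite mxE.
exact: smooth_at_difv.
Qed.

Lemma smooth_gnu h y : smooth_at h y -> smooth_at (gnu h) y.
Proof.
move=> sh; apply/smooth_at_coord => k; under eq_fun do rewrite mxE.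
exact: smooth_at_difv.
Qed.

(** [red_bracket] in the coordinates (q, mu, nu) of the chart [i]. The pairing of T_e^* R_g dh/dg
    with a vector becomes the derivative of [h] along a right-invariant field, without reference to
    the preferred chart of the moving point. *)
Definition lie_poisson_coord (i : chart A) (h k : Y -> R) (y : Y) : R :=
  dif h y (row_mx (rvec i (par i (lsubmx y)) (gmu k y)) 0)
  - dif k y (row_mx (rvec i (par i (lsubmx y)) (gmu h y)) 0)
  + pairing (lsubmx (rsubmx y)) (brk (gmu h y) (gmu k y))
  + pairing (rsubmx (rsubmx y)) (brk (gmu h y) (gnu k y) - brk (gmu k y) (gnu h y)).

Lemma smooth_lie_poisson_coord i h k x w : dom i x ->
  smooth_at h (row_mx (crd i x) w) -> smooth_at k (row_mx (crd i x) w) ->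
  smooth_at (lie_poisson_coord i h k) (row_mx (crd i x) w).
Proof.
move=> ix sh sk; set y := row_mx _ _.
have sr (u : Y -> 'rV[R]_n) : smooth_at u y ->
    smooth_at (fun z => row_mx (rvec i (par i (lsubmx z)) (u z)) 0 : Y) y.
  move=> su; apply: smooth_at_row_mx; last exact: smooth_at_cst.
  apply: (smooth_at_rvec hG) => //; last by rewrite row_mxKl (crdK hA ix).
  apply: plot_comp; first exact: smooth_at_lsubmx (smooth_at_id _).
  by rewrite row_mxKl; exact: (plot_par hA ix).
have s1 := smooth_gmu sh; have s2 := smooth_gmu sk.
have s3 := smooth_gnu sh; have s4 := smooth_gnu sk.
have sid : smooth_at id y by exact: smooth_at_id.
apply: smooth_atD; last first.
  apply: smooth_pairing; first exact: smooth_at_rsubmx (smooth_at_rsubmx sid).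
  by apply: smooth_atB; exact: smooth_brk.
apply: smooth_atD; last first.
  apply: smooth_pairing; first exact: smooth_at_lsubmx (smooth_at_rsubmx sid).
  exact: smooth_brk.
by apply: smooth_atB; apply: smooth_at_dif => //; exact: sr.
Qed.

Lemma lie_poisson_coordC i h k y : lie_poisson_coord i h k y = - lie_poisson_coord i k h y.
Proof.
rewrite /lie_poisson_coord (brkC hG (gmu h y) (gmu k y)) !pairingBr pairingNr.
ring.
Qed.

(** At a point the bracket depends on [h] only through its differential, and linearly. Linearity and
    the Leibniz rule of the reduced bracket are two instances. *)
Lemma lie_poisson_coord_comb i h h1 h2 k y (a b : R) :
  (forall v, dif h y v = a * dif h1 y v + b * dif h2 y v) ->
  lie_poisson_coord i h k y = a * lie_poisson_coord i h1 k y + b * lie_poisson_coord i h2 k y.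
Proof.
move=> H.
have Hm : gmu h y = a *: gmu h1 y + b *: gmu h2 y by apply/rowP => j; rewrite !mxE H.
have Hn : gnu h y = a *: gnu h1 y + b *: gnu h2 y by apply/rowP => j; rewrite !mxE H.
have L (f : 'rV[R]_n -> 'rV[R]_n) u v : linear f -> f (a *: u + b *: v) = a *: f u + b *: f v.
  move=> lf; rewrite lf; congr (_ + _); have := lf b v 0.
  rewrite addr0 => ->; have := lf (-1) 0 0; rewrite scaler0 addr0 scaleN1r => ->.
  by rewrite addNr addr0.
rewrite /lie_poisson_coord H Hm Hn.
set g := par i _.
rewrite (L _ _ _ (rvec_linear i g)) (L _ _ _ (brk_linearr hG (gmu k y))).
rewrite (L (fun u => brk u (gmu k y)) _ _ (brk_linearl _)).
rewrite (L (fun u => brk u (gnu k y)) _ _ (brk_linearl _)).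
have -> : row_mx (a *: rvec i g (gmu h1 y) + b *: rvec i g (gmu h2 y)) 0 =
    a *: (row_mx (rvec i g (gmu h1 y)) 0 : Y) + b *: (row_mx (rvec i g (gmu h2 y)) 0 : Y).
  by rewrite !scale_row_mx add_row_mx !scaler0 addr0.
rewrite linearD !linearZ /= !pairingBr !pairingDr !pairingZr /GRing.scale /=.
ring.
Qed.

Definition rpar (i : chart A) (y : Y) : P :=
  (par i (lsubmx y), (lsubmx (rsubmx y), rsubmx (rsubmx y))).

Lemma rparE i q mu nu : rpar i (row_mx q (row_mx mu nu)) = (par i q, (mu, nu)).
Proof. by rewrite /rpar !row_mxKr !row_mxKl. Qed.

Lemma rpar_split i y : rpar i y = (par i (lsubmx y), (lsubmx (rsubmx y), rsubmx (rsubmx y))).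
Proof. by []. Qed.

Lemma reduced_manifold : smooth_manifold (reduced A).
Proof.
apply: prod_manifold; first exact: hA.
by apply: prod_manifold; exact: vec_manifold.
Qed.

Lemma smooth_rpar (H : P -> R) i x w : smooth_fun (reduced A) H -> dom i x ->
  smooth_at (H \o rpar i) (row_mx (crd i x) w).
Proof.
move=> /(smooth_funP reduced_manifold) sH ix.
have := sH ((i, (tt, tt)) : chart (reduced A)) (x, (lsubmx w, rsubmx w)).
by rewrite /= hsubmxK; apply.
Qed.

Section AtPoint.
Variables (i : chart A) (g : G) (mu nu : 'rV[R]_n).
Hypothesis ig : dom i g.
Local Notation y := (row_mx (crd i g) (row_mx mu nu)).

Lemma d_muE H : smooth_fun (reduced A) H -> d_mu H g mu nu = gmu (H \o rpar i) y.
Proof.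
move=> sH; apply/rowP => k; rewrite !mxE -difE.
have s1 (w : 'rV[R]_n) : smooth_at (fun mu' => row_mx (crd i g) (row_mx mu' nu)) w.
  by do 2?[apply: smooth_at_row_mx]; try exact: smooth_at_cst; exact: smooth_at_id.
have := dif_comp (delta_mx ord0 k) (s1 mu) (smooth_rpar (row_mx mu nu) sH ig).
rewrite dif_row_mx; [|exact: smooth_at_cst|]; last first.
  by apply: smooth_at_row_mx; [exact: smooth_at_id|exact: smooth_at_cst].
rewrite dif_row_mx; [|exact: smooth_at_id|exact: smooth_at_cst].
rewrite !dif_cst dif_id => <-; apply: eq_dif => m /=.
by rewrite rparE (crdK hA ig).
Qed.

Lemma d_nuE H : smooth_fun (reduced A) H -> d_nu H g mu nu = gnu (H \o rpar i) y.
Proof.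
move=> sH; apply/rowP => k; rewrite !mxE -difE.
have s1 (w : 'rV[R]_n) : smooth_at (fun nu' => row_mx (crd i g) (row_mx mu nu')) w.
  by do 2?[apply: smooth_at_row_mx]; try exact: smooth_at_cst; exact: smooth_at_id.
have := dif_comp (delta_mx ord0 k) (s1 nu) (smooth_rpar (row_mx mu nu) sH ig).
rewrite dif_row_mx; [|exact: smooth_at_cst|]; last first.
  by apply: smooth_at_row_mx; [exact: smooth_at_cst|exact: smooth_at_id].
rewrite dif_row_mx; [|exact: smooth_at_cst|exact: smooth_at_id].
rewrite !dif_cst dif_id => <-; apply: eq_dif => m /=.
by rewrite rparE (crdK hA ig).
Qed.

Lemma pairing_TRstar alpha b :
  pairing (TRstar A g alpha) b = pairing alpha (rvec (chart_at A g) g b).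
Proof.
rewrite -(pairing_dual_repr (f := fun b => pairing alpha (rvec (chart_at A g) g b))).
  congr (pairing _ _); apply/rowP => k; rewrite !mxE.
  by rewrite tmap_mulr.
by move=> a u v; rewrite rvec_linear pairing_linearr.
Qed.

(** [TRstar] and [d_g] both go through the preferred chart at [g], which cancels: read there or in
    [i], the pairing is the derivative at the identity of z |-> H (z g, mu, nu). *)
Lemma pairing_d_g H b : smooth_fun (reduced A) H ->
  pairing (TRstar A g (d_g A H g mu nu)) b = dif (H \o rpar i) y (row_mx (rvec i g b) 0).
Proof.
move=> sH; rewrite pairing_TRstar.
have sj (j : chart A) : dom j g ->
    smooth_at ((fun h => H (h, (mu, nu))) \o par j) (crd j g).
  move=> jg.
  have s1 : smooth_at (fun q => row_mx q (row_mx mu nu)) (crd j g).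
    by apply: smooth_at_row_mx; [exact: smooth_at_id|exact: smooth_at_cst].
  have := smooth_at_comp s1 (smooth_rpar (row_mx mu nu) sH jg).
  by apply: smooth_at_ext; near=> q; rewrite /= rparE.
have cg := chart_atP hA g.
rewrite pairing_dual_repr; last by move=> a u v; rewrite /mdiff linearP.
rewrite /mdiff -difE -(dif_rvec hG b cg (sj _ cg)) (dif_rvec hG b ig (sj _ ig)).
rewrite -dif_partiall; last exact: smooth_rpar.
by apply: eq_dif => q; rewrite /= rparE.
Unshelve. all: by end_near. Qed.

Lemma red_bracket_loc H K : smooth_fun (reduced A) H -> smooth_fun (reduced A) K ->
  red_bracket A H K (g, (mu, nu)) = lie_poisson_coord i (H \o rpar i) (K \o rpar i) y.
Proof.
move=> sH sK; have E (a b c d : 'rV[R]_n) (dh dk : 'rV[R]_n -> R) :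
    d_mu H g mu nu = a -> d_mu K g mu nu = b ->
    d_nu H g mu nu = c -> d_nu K g mu nu = d ->
    (forall v, pairing (TRstar A g (d_g A H g mu nu)) v = dh v) ->
    (forall v, pairing (TRstar A g (d_g A K g mu nu)) v = dk v) ->
    red_bracket A H K (g, (mu, nu)) =
    dh b - dk a + pairing mu (brk a b) + pairing nu (brk a d - brk b c).
  move=> <- <- <- <- hh hk; rewrite /red_bracket bracket_brk.
  congr (_ - _ + _ + _); [exact: hh|exact: hk].
rewrite (E _ _ _ _ _ _ (d_muE sH) (d_muE sK) (d_nuE sH) (d_nuE sK)
  (fun v => pairing_d_g v sH) (fun v => pairing_d_g v sK)).
by rewrite /lie_poisson_coord !row_mxKr !row_mxKl (crdK hA ig).
Qed.

End AtPoint.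

Lemma red_bracket_rpar i x w H K : dom i x ->
  smooth_fun (reduced A) H -> smooth_fun (reduced A) K ->
  \forall y \near row_mx (crd i x) w,
    lie_poisson_coord i (H \o rpar i) (K \o rpar i) y = (red_bracket A H K \o rpar i) y.
Proof.
move=> ix sH sK.
have c : \forall y \near (row_mx (crd i x) w : Y), dom i (par i (lsubmx y)) /\ crd i (par i (lsubmx y)) = lsubmx y.
  have := smooth_at_continuous (smooth_at_lsubmx (smooth_at_id (row_mx (crd i x) w : Y))).
  rewrite /prop_for /continuous_at row_mxKl => h; exact: (h _ (near_par hA ix)).
apply: filterS c => y [yi e].
rewrite -[RHS]/(red_bracket A H K (rpar i y)) rpar_split (red_bracket_loc _ _ yi sH sK) e.
by rewrite -[in LHS](hsubmxK y) -[in LHS](hsubmxK (rsubmx y)).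
Qed.

Lemma smooth_red_bracket H K :
  smooth_fun (reduced A) H -> smooth_fun (reduced A) K ->
  smooth_fun (reduced A) (red_bracket A H K).
Proof.
move=> sH sK; apply/(smooth_funP reduced_manifold) => -[i [[] []]] [x [mu nu]] [/= ix _].
apply: smooth_at_ext (red_bracket_rpar (row_mx mu nu) ix sH sK) _.
by apply: smooth_lie_poisson_coord => //; exact: smooth_rpar.
Qed.

End LiePoisson.

(** * The reduced bracket as a canonical bracket *)

Section Lift.
Context {R : realType} {n : nat} {G : groupType} {A : atlas R n G}.
Implicit Types V W : normedModType R.
Hypothesis hG : lie_group A.
Local Notation hA := (lie_manifold hG).
Local Notation P := (G * ('rV[R]_n * 'rV[R]_n))%type.
Local Notation Y := 'rV[R]_(n + (n + n)).
Local Notation Z := 'rV[R]_((n + n) + (n + n)).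
Local Notation rvec := (@rvec R n G A).
Local Notation brk := (@brk R n G A).

(* mu = T_e^*R_q p + ad^*_xi pi, for y = (q, xi, p, pi) canonical coordinates of
   T^*TG. *)
Definition mu_coord (i : chart A) (y : Z) : 'rV[R]_n :=
  \row_k (pairing (lsubmx (rsubmx y)) (rvec i (par i (lsubmx (lsubmx y))) (delta_mx ord0 k))
          - pairing (rsubmx (rsubmx y)) (brk (rsubmx (lsubmx y)) (delta_mx ord0 k))).

(** The projection of T^*TG to the reduced space, from canonical coordinates to (q, mu, nu);
    [canbr_red_coord] says that it is a Poisson map. *)
Definition red_coord (i : chart A) (y : Z) : Y :=
  row_mx (lsubmx (lsubmx y)) (row_mx (mu_coord i y) (rsubmx (rsubmx y))).

Lemma pairing_mu_coord i y a : pairing (mu_coord i y) a =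
  pairing (lsubmx (rsubmx y)) (rvec i (par i (lsubmx (lsubmx y))) a)
    - pairing (rsubmx (rsubmx y)) (brk (rsubmx (lsubmx y)) a).
Proof.
pose f a := pairing (lsubmx (rsubmx y)) (rvec i (par i (lsubmx (lsubmx y))) a)
    - pairing (rsubmx (rsubmx y)) (brk (rsubmx (lsubmx y)) a).
rewrite -[RHS]/(f a) -(pairing_dual_repr (f := f)) //.
move=> k u v; rewrite /f rvec_linear (brk_linearr hG) !pairingDr !pairingZr /GRing.scale /=.
ring.
Qed.

Section AtPoint.
Variables (i : chart A) (g : G) (xi p pi : 'rV[R]_n).
Hypothesis ig : dom i g.
Let y : Z := row_mx (row_mx (crd i g) xi) (row_mx p pi).

Let ql : lsubmx (lsubmx y) = crd i g. Proof. by rewrite !row_mxKl. Qed.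
Let xl : rsubmx (lsubmx y) = xi. Proof. by rewrite row_mxKl row_mxKr. Qed.
Let pl : lsubmx (rsubmx y) = p. Proof. by rewrite row_mxKr row_mxKl. Qed.
Let pil : rsubmx (rsubmx y) = pi. Proof. by rewrite !row_mxKr. Qed.

Let sid : smooth_at (id : Z -> Z) y. Proof. exact: smooth_at_id. Qed.
Let sq : smooth_at (fun z : Z => lsubmx (lsubmx z)) y.
Proof. exact: smooth_at_lsubmx (smooth_at_lsubmx sid). Qed.
Let sx : smooth_at (fun z : Z => rsubmx (lsubmx z)) y.
Proof. exact: smooth_at_rsubmx (smooth_at_lsubmx sid). Qed.
Let sp : smooth_at (fun z : Z => lsubmx (rsubmx z)) y.
Proof. exact: smooth_at_lsubmx (smooth_at_rsubmx sid). Qed.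
Let spi : smooth_at (fun z : Z => rsubmx (rsubmx z)) y.
Proof. exact: smooth_at_rsubmx (smooth_at_rsubmx sid). Qed.

Let pq : plot A (fun z : Z => par i (lsubmx (lsubmx z))) y.
Proof. by apply: (plot_comp sq); rewrite ql; exact: (plot_par hA ig). Qed.

Let srv a : smooth_at (fun z : Z => rvec i (par i (lsubmx (lsubmx z))) a) y.
Proof.
apply: (smooth_at_rvec hG pq (smooth_at_cst _ _)).
by rewrite ql (crdK hA ig).
Qed.

Let sb a : smooth_at (fun z : Z => brk (rsubmx (lsubmx z)) a) y.
Proof. exact: (smooth_brk hG sx (smooth_at_cst _ _)). Qed.

Lemma smooth_mu_coord : smooth_at (mu_coord i) y.
Proof.
apply/smooth_at_coord => k; under eq_fun do rewrite mxE.
by apply: smooth_atB; apply: smooth_pairing.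
Qed.

Lemma smooth_red_coord : smooth_at (red_coord i) y.
Proof. by apply: smooth_at_row_mx => //; apply: smooth_at_row_mx => //; exact: smooth_mu_coord. Qed.

Lemma pairing_dif_mu_coord (u z s r a : 'rV[R]_n) :
  pairing (dif (mu_coord i) y (row_mx (row_mx u z) (row_mx s r))) a =
  pairing s (rvec i g a) + pairing p (dif (fun q => rvec i (par i q) a) (crd i g) u)
  - (pairing r (brk xi a) + pairing pi (brk z a)).
Proof.
set v := row_mx _ _.
rewrite -(dif_linear_comp v (pairing_linearl a) smooth_mu_coord).
rewrite (eq_dif _ _ (fun z => pairing_mu_coord i z a)).
have dql : dif (fun z : Z => lsubmx (lsubmx z)) y v = u.
  by rewrite (dif_of_linear _ _ (l := fun z : Z => lsubmx (lsubmx z))) ?row_mxKl //; move=> ? ? ?; rewrite !linearP.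
have dxl : dif (fun z : Z => rsubmx (lsubmx z)) y v = z.
  by rewrite (dif_of_linear _ _ (l := fun z : Z => rsubmx (lsubmx z))) ?row_mxKl ?row_mxKr //; move=> ? ? ?; rewrite !linearP.
have dpl : dif (fun z : Z => lsubmx (rsubmx z)) y v = s.
  by rewrite (dif_of_linear _ _ (l := fun z : Z => lsubmx (rsubmx z))) ?row_mxKr ?row_mxKl //; move=> ? ? ?; rewrite !linearP.
have dpil : dif (fun z : Z => rsubmx (rsubmx z)) y v = r.
  by rewrite (dif_of_linear _ _ (l := fun z : Z => rsubmx (rsubmx z))) ?row_mxKr //; move=> ? ? ?; rewrite !linearP.
rewrite difB; [|exact: smooth_pairing|exact: smooth_pairing].
rewrite !dif_pairing // dpl dpil pl pil xl ql (crdK hA ig).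
have sr := smooth_rvec_par hG a ig.
rewrite -ql in sr; rewrite (dif_comp v sq sr) dql ql.
by rewrite (dif_linear_comp v (brk_linearl a) sx) dxl.
Qed.

Lemma red_coord_point : red_coord i y = row_mx (crd i g) (row_mx (mu_coord i y) pi).
Proof. by rewrite /red_coord ql pil. Qed.

Lemma dif_red_coord (u z s r : 'rV[R]_n) (v := row_mx (row_mx u z) (row_mx s r) : Z) :
  dif (red_coord i) y v = row_mx u (row_mx (dif (mu_coord i) y v) r).
Proof.
rewrite /red_coord dif_row_mx //; last by apply: smooth_at_row_mx => //; exact: smooth_mu_coord.
rewrite dif_row_mx //; last exact: smooth_mu_coord.
rewrite (dif_of_linear _ _ (l := fun z : Z => lsubmx (lsubmx z))); last by move=> ? ? ?; rewrite !linearP.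
rewrite (dif_of_linear _ _ (l := fun z : Z => rsubmx (rsubmx z))); last by move=> ? ? ?; rewrite !linearP.
by rewrite /v !row_mxKl !row_mxKr.
Qed.

(** The coefficients of [u], [z], [s], [r] are the derivatives in q, xi, p, pi that enter the
    canonical bracket. The vector [gmu h] is frozen at the point while [rvec] is differentiated. *)
Lemma dif_comp_red_coord (h : Y -> R) (u z s r : 'rV[R]_n) : smooth_at h (red_coord i y) ->
  dif (h \o red_coord i) y (row_mx (row_mx u z) (row_mx s r)) =
  (dif h (red_coord i y) (row_mx u 0) +
   pairing p (dif (fun q => rvec i (par i q) (gmu h (red_coord i y))) (crd i g) u))
  - pairing pi (brk z (gmu h (red_coord i y)))
  + pairing s (rvec i g (gmu h (red_coord i y)))
  + pairing r (gnu h (red_coord i y) - brk xi (gmu h (red_coord i y))).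
Proof.
move=> sh; rewrite (dif_comp _ smooth_red_coord sh) dif_red_coord dif_split.
rewrite (pairingC (gmu _ _)) pairing_dif_mu_coord (pairingC (gnu _ _)) pairingBr.
ring.
Qed.

(* The terms of the derivative of q |-> rvec i q form a commutator, which
   [rvec_commutator] turns into the term <T_e^*R_q p, [., .]>; the terms in
   ad^*_xi pi combine by the Jacobi identity. *)
Lemma canbr_red_coord (h k : Y -> R) : smooth_at h (red_coord i y) -> smooth_at k (red_coord i y) ->
  canbr (h \o red_coord i) (k \o red_coord i) y = lie_poisson_coord i h k (red_coord i y).
Proof.
move=> sh sk; set Y0 := red_coord i y.
have D f (sf : smooth_at f Y0) u z s r := dif_comp_red_coord u z s r sf.
(* [a f], [b f] and [c f] are the derivatives of the lift of [f] in q, xi and pi; the one in p is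
   [rvec i g (gmu f Y0)]. *)
pose a f u := dif f Y0 (row_mx u 0) + pairing p (dif (fun q => rvec i (par i q) (gmu f Y0)) (crd i g) u).
pose b f (z : 'rV[R]_n) := - pairing pi (brk z (gmu f Y0)).
pose c f := gnu f Y0 - brk xi (gmu f Y0).
have aL f : linear (a f).
  move=> t u v; rewrite /a (dif_linear (fun q => rvec i (par i q) _)) pairingDr pairingZr.
  have -> : row_mx (t *: u + v) 0 = t *: (row_mx u 0 : Y) + row_mx v 0.
    by rewrite scale_row_mx add_row_mx scaler0 addr0.
  by rewrite dif_linear /GRing.scale /=; ring.
have bL f : linear (b f).
  by move=> t u v; rewrite /b brk_linearl pairingDr pairingZr /GRing.scale /=; ring.
have Dq f (sf : smooth_at f Y0) u : dif (f \o red_coord i) y (row_mx (row_mx u 0) 0) = a f u.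
  rewrite -row_mx0 D // /a (_ : brk 0 _ = 0); last exact: dif0.
  by rewrite !pairing0l pairing0r subr0 !addr0.
have Dx f (sf : smooth_at f Y0) z : dif (f \o red_coord i) y (row_mx (row_mx 0 z) 0) = b f z.
  rewrite -[X in row_mx _ X]row_mx0 D // row_mx0 !dif0 !pairing0l pairing0r.
  by rewrite /b !addr0 sub0r.
have Dp f (sf : smooth_at f Y0) s r : dif (f \o red_coord i) y (row_mx 0 (row_mx s r)) =
    pairing s (rvec i g (gmu f Y0)) + pairing r (c f).
  rewrite -[X in row_mx X _]row_mx0 D // row_mx0 !dif0 pairing0r.
  rewrite (_ : brk 0 _ = 0); last exact: dif0.
  by rewrite pairing0r subr0 !add0r.
rewrite /canbr big_split_ord /=.
(* The sum over the basis evaluates the linear form d/dq of one function at the vector d/dp of the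
   other; the next one does the same for xi and pi. *)
have -> : \sum_(j < n) (dif (h \o red_coord i) y (row_mx (delta_mx ord0 (lshift n j)) 0) *
      dif (k \o red_coord i) y (row_mx 0 (delta_mx ord0 (lshift n j))) -
      dif (h \o red_coord i) y (row_mx 0 (delta_mx ord0 (lshift n j))) *
      dif (k \o red_coord i) y (row_mx (delta_mx ord0 (lshift n j)) 0)) =
    a h (rvec i g (gmu k Y0)) - a k (rvec i g (gmu h Y0)).
  rewrite (linear_rV_expand (rvec i g (gmu k Y0)) (aL h)) (linear_rV_expand (rvec i g (gmu h Y0)) (aL k)).
  rewrite -sumrB; apply: eq_bigr => j _.
  rewrite delta_mx_lshift !Dq // !Dp // !pairing0l !addr0 !(pairingC (delta_mx _ _)) !pairing_delta.
  by rewrite /GRing.scale /=; ring.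
have -> : \sum_(j < n) (dif (h \o red_coord i) y (row_mx (delta_mx ord0 (rshift n j)) 0) *
      dif (k \o red_coord i) y (row_mx 0 (delta_mx ord0 (rshift n j))) -
      dif (h \o red_coord i) y (row_mx 0 (delta_mx ord0 (rshift n j))) *
      dif (k \o red_coord i) y (row_mx (delta_mx ord0 (rshift n j)) 0)) =
    b h (c k) - b k (c h).
  rewrite (linear_rV_expand (c k) (bL h)) (linear_rV_expand (c h) (bL k)).
  rewrite -sumrB; apply: eq_bigr => j _.
  rewrite delta_mx_rshift !Dx // !Dp // !pairing0l !add0r !(pairingC (delta_mx _ _)) !pairing_delta.
  by rewrite /GRing.scale /=; ring.
rewrite /a /b /c /lie_poisson_coord.
set hm := gmu h Y0; set km := gmu k Y0; set hn := gnu h Y0; set kn := gnu k Y0.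
have -> : lsubmx Y0 = crd i g by rewrite /Y0 red_coord_point row_mxKl.
have -> : lsubmx (rsubmx Y0) = mu_coord i y by rewrite /Y0 red_coord_point row_mxKr row_mxKl.
have -> : rsubmx (rsubmx Y0) = pi by rewrite /Y0 red_coord_point !row_mxKr.
rewrite (crdK hA ig) pairing_mu_coord pl pil xl ql (crdK hA ig).
rewrite -(rvec_commutator hG hm km ig).
rewrite (brk_jacobi hG xi hm km).
have -> : brk (kn - brk xi km) hm = - brk hm kn + brk hm (brk xi km).
  by rewrite (brkC hG) (brkBr hG) opprB addrC.
have -> : brk (hn - brk xi hm) km = - brk km hn - brk (brk xi hm) km.
  by rewrite (brkDl hG) (brkNl hG) (brkC hG hn).
rewrite !pairingBr !pairingDr !pairingNr.
ring.
Qed.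

End AtPoint.

(** At xi = 0 the term in ad^* vanishes, and p is the preimage of [mu] under the invertible map
    T_e^* R_g. *)
Lemma red_coord_onto i g mu nu : dom i g -> exists p,
  red_coord i (row_mx (row_mx (crd i g) 0) (row_mx p nu)) = row_mx (crd i g) (row_mx mu nu).
Proof.
move=> ig; pose f v := pairing mu (rinv i g v).
have lf : linear f by move=> a u v; rewrite /f rinv_linear pairing_linearr.
exists (dual_repr f); rewrite red_coord_point //; congr (row_mx _ (row_mx _ _)).
apply: pairing_ext => a; rewrite pairing_mu_coord !row_mxKl !row_mxKr !row_mxKl.
rewrite (_ : brk 0 _ = 0); last exact: dif0.
by rewrite pairing0r subr0 (crdK hA ig) pairing_dual_repr // /f rvecK.
Qed.

Lemma canbr_red H K i g xi p pi (y := row_mx (row_mx (crd i g) xi) (row_mx p pi) : Z) :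
  dom i g -> smooth_fun (reduced A) H -> smooth_fun (reduced A) K ->
  canbr (H \o rpar i \o red_coord i) (K \o rpar i \o red_coord i) y =
  red_bracket A H K (rpar i (red_coord i y)).
Proof.
move=> ig sH sK.
have sl F : smooth_fun (reduced A) F -> smooth_at (F \o rpar i) (red_coord i y).
  by move=> sF; rewrite red_coord_point; exact: (smooth_rpar hG).
rewrite (canbr_red_coord ig (sl _ sH) (sl _ sK)) red_coord_point.
by rewrite rparE (crdK hA ig) (red_bracket_loc hG _ _ ig sH sK).
Qed.

(** The proof of the Jacobi identity differentiates [canbr_red], which must therefore hold on a
    neighbourhood: nearby coordinates still come from points of the chart. *)
Lemma near_row_mx (i : chart A) g (y : Z) : dom i g -> lsubmx (lsubmx y) = crd i g ->
  \forall z \near y, exists2 g', dom i g' &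
    z = row_mx (row_mx (crd i g') (rsubmx (lsubmx z))) (row_mx (lsubmx (rsubmx z)) (rsubmx (rsubmx z))).
Proof.
move=> ig yg.
have c := smooth_at_continuous (smooth_at_lsubmx (smooth_at_lsubmx (smooth_at_id y))).
have H : \forall z \near y, dom i (par i (lsubmx (lsubmx z))) /\ crd i (par i (lsubmx (lsubmx z))) = lsubmx (lsubmx z).
  move: c; rewrite /prop_for /continuous_at yg => h; exact: (h _ (near_par hA ig)).
apply: filterS H => z [zi e]; exists (par i (lsubmx (lsubmx z))) => //.
by rewrite e !hsubmxK.
Qed.

(* The brackets are canonical brackets of pullbacks by [red_coord], which reaches
   every point. *)
Lemma red_bracket_jacobi H K L x :
  smooth_fun (reduced A) H -> smooth_fun (reduced A) K -> smooth_fun (reduced A) L ->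
  red_bracket A (red_bracket A H K) L x + red_bracket A (red_bracket A K L) H x
  + red_bracket A (red_bracket A L H) K x = 0.
Proof.
move=> sH sK sL; case: x => g [mu nu].
pose i := chart_at A g; have ig : dom i g by exact: (chart_atP hA).
have [p lp] := red_coord_onto mu nu ig.
pose y : Z := row_mx (row_mx (crd i g) 0) (row_mx p nu).
have -> : (g, (mu, nu)) = rpar i (red_coord i y) by rewrite lp rparE (crdK hA ig).
have sHK := smooth_red_bracket hG sH sK; have sKL := smooth_red_bracket hG sK sL.
have sLH := smooth_red_bracket hG sL sH.
have near_br F F' : smooth_fun (reduced A) F -> smooth_fun (reduced A) F' ->
    \forall z \near y, canbr (F \o rpar i \o red_coord i) (F' \o rpar i \o red_coord i) z =
       (red_bracket A F F' \o rpar i \o red_coord i) z.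
  move=> sF sF'; have yg : lsubmx (lsubmx y) = crd i g by rewrite !row_mxKl.
  by apply: filterS (near_row_mx ig yg) => z [g' ig' ->]; exact: canbr_red.
have sl F : smooth_fun (reduced A) F -> smooth_at (F \o rpar i \o red_coord i) y.
  move=> sF; apply: (smooth_at_comp (smooth_red_coord 0 p nu ig)).
  by rewrite red_coord_point; exact: (smooth_rpar hG).
(* The outer bracket takes derivatives of the inner one at [y] only, so the inner one may be
   replaced by a function equal to it near [y]. *)
have E F F' K' : smooth_fun (reduced A) F -> smooth_fun (reduced A) F' ->
   canbr (red_bracket A F F' \o rpar i \o red_coord i) K' y =
   canbr (canbr (F \o rpar i \o red_coord i) (F' \o rpar i \o red_coord i)) K' y.
  move=> sF sF'; apply: eq_bigr => k _.
  have s := smooth_canbr (sl _ sF) (sl _ sF').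
  by rewrite !(near_eq_dif _ (near_br _ _ sF sF') s).
pose l (F : P -> R) := F \o rpar i \o red_coord i.
transitivity (canbr (canbr (l H) (l K)) (l L) y + canbr (canbr (l K) (l L)) (l H) y +
  canbr (canbr (l L) (l H)) (l K) y); last by apply: canbr_jacobi; exact: sl.
congr (_ + _ + _); apply: etrans (esym (canbr_red 0 p nu ig _ _)) (E _ _ _ _ _) => //.
Qed.

Lemma red_bracketC H K x : smooth_fun (reduced A) H -> smooth_fun (reduced A) K ->
  red_bracket A H K x = - red_bracket A K H x.
Proof.
case: x => g [mu nu] sH sK; have ig := chart_atP hA g.
by rewrite !(red_bracket_loc hG _ _ ig) // (lie_poisson_coordC hG).
Qed.

Lemma smooth_fun_comb (a : R) H K : smooth_fun (reduced A) H -> smooth_fun (reduced A) K ->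
  smooth_fun (reduced A) (fun y => a * H y + K y).
Proof.
have hR := reduced_manifold hG.
move=> /(smooth_funP hR) sH /(smooth_funP hR) sK; apply/(smooth_funP hR) => i x ix.
apply: smooth_atD; last exact: sK.
by apply: smooth_atM; [exact: smooth_at_cst|exact: sH].
Qed.

Lemma smooth_fun_mul H K : smooth_fun (reduced A) H -> smooth_fun (reduced A) K ->
  smooth_fun (reduced A) (fun y => H y * K y).
Proof.
have hR := reduced_manifold hG.
move=> /(smooth_funP hR) sH /(smooth_funP hR) sK; apply/(smooth_funP hR) => i x ix.
by apply: smooth_atM; [exact: sH|exact: sK].
Qed.

Lemma red_bracket_poisson : poisson_manifold (reduced A) (red_bracket A).
Proof.
split; first exact: reduced_manifold.
move=> H K L sH sK sL; split.
- exact: smooth_red_bracket.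
- move=> a [g [mu nu]]; have ig := chart_atP hA g.
  rewrite !(red_bracket_loc hG _ _ ig) //; last exact: smooth_fun_comb.
  rewrite (@lie_poisson_coord_comb _ _ _ _ hG _ _ (H \o rpar (chart_at A g)) (K \o rpar (chart_at A g)) _ _ a 1) ?mul1r // => v.
  have [s1 s2] : smooth_at (H \o rpar (chart_at A g)) (row_mx (crd (chart_at A g) g) (row_mx mu nu)) /\
      smooth_at (K \o rpar (chart_at A g)) (row_mx (crd (chart_at A g) g) (row_mx mu nu)).
    by split; exact: (smooth_rpar hG).
  have s0 : smooth_at (fun=> a) (row_mx (crd (chart_at A g) g) (row_mx mu nu)) by exact: smooth_at_cst.
  rewrite (difD v (smooth_atM s0 s1) s2) (difM v s0 s1) dif_cst.
  by rewrite mul0r add0r mul1r.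
- by move=> x; exact: red_bracketC.
- move=> [g [mu nu]]; have ig := chart_atP hA g.
  rewrite !(red_bracket_loc hG _ _ ig) //; last exact: smooth_fun_mul.
  (* The differential of the product is H dK + K dH, so the weights are the values of [H] and [K] at
     the point. *)
  rewrite (@lie_poisson_coord_comb _ _ _ _ hG _ _ (K \o rpar (chart_at A g)) (H \o rpar (chart_at A g)) _ _ (H (g, (mu, nu))) (K (g, (mu, nu)))) => [|v].
    by rewrite [X in _ + X]mulrC.
  have [s1 s2] : smooth_at (H \o rpar (chart_at A g)) (row_mx (crd (chart_at A g) g) (row_mx mu nu)) /\
      smooth_at (K \o rpar (chart_at A g)) (row_mx (crd (chart_at A g) g) (row_mx mu nu)).
    by split; exact: (smooth_rpar hG).
  rewrite (difM v s1 s2) /= rparE (crdK hA ig).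
  by rewrite addrC mulrC [X in _ + X]mulrC [X in X + _]mulrC.
- by move=> x; exact: red_bracket_jacobi.
Qed.

End Lift.

(** * The canonical form of a cotangent bundle *)

Section Cotangent.
Context {R : realType} {N : nat} {Q : Type} {A : atlas R N Q}.
Hypothesis hA : smooth_manifold A.
Local Notation Z := 'rV[R]_(N + N).

Lemma tparE (c : chart A) z w : dom c z ->
  tpar c (crd c z) w = dif (crd (chart_at A z) \o par c) (crd c z) w.
Proof. by move=> cz; rewrite /tpar (crdK hA cz) difE. Qed.

Lemma tcrdE (c : chart A) z w :
  tcrd c z w = dif (crd c \o par (chart_at A z)) (crd (chart_at A z) z) w.
Proof. by rewrite /tcrd difE. Qed.

Lemma tcrd_linear (c : chart A) z : linear (tcrd c z).
Proof. by move=> a u v; rewrite /tcrd linearP. Qed.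

Lemma dif_transition (i j c : chart A) z w : dom i z -> dom j z -> dom c z ->
  dif (crd i \o par j) (crd j z) (dif (crd j \o par c) (crd c z) w) =
  dif (crd i \o par c) (crd c z) w.
Proof.
move=> iz jz cz; have pj : dom j (par c (crd c z)) by rewrite (crdK hA cz).
have := @dif_plot _ _ _ _ hA _ _ (par c) (crd c z) j (crd i) w (plot_par hA cz) pj.
rewrite (crdK hA cz) => h; apply: esym; apply: h.
exact: (smooth_transition hA).
Qed.

Lemma tcrd_tpar (i c : chart A) z w : dom i z -> dom c z ->
  tcrd i z (tpar c (crd c z) w) = dif (crd i \o par c) (crd c z) w.
Proof.
move=> iz cz; rewrite tcrdE tparE //; apply: dif_transition => //.
exact: (chart_atP hA).
Qed.

Lemma dif_chart_id (i : chart A) z w : dom i z -> dif (crd i \o par i) (crd i z) w = w.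
Proof.
move=> iz; have E : \forall q \near crd i z, id q = (crd i \o par i) q.
  by apply: filterS (near_par hA iz) => q [_ /= ->].
by rewrite (near_eq_dif _ E) ?dif_id //; exact: smooth_at_id.
Qed.

Lemma near_cotangent (i : chart A) z (y : Z) : dom i z -> lsubmx y = crd i z ->
  \forall y' \near y, dom i (par i (lsubmx y')) /\ crd i (par i (lsubmx y')) = lsubmx y'.
Proof.
move=> iz yz; have := smooth_at_continuous (smooth_at_lsubmx (smooth_at_id y)).
rewrite /prop_for /continuous_at yz => h; exact: (h _ (near_par hA iz)).
Qed.

Section Theta.
Variables (i : chart A) (z : Q) (p : 'rV[R]_N).
Hypothesis iz : dom i z.
Let y : Z := row_mx (crd i z) p.
Let c := chart_at A z.
Let cz : dom c z. Proof. exact: (chart_atP hA). Qed.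

Let yl : lsubmx y = crd i z. Proof. by rewrite row_mxKl. Qed.

(** The transition of the cotangent bundle from the chart [i] to [c]. The fibre part uses the
    transposed Jacobian of the inverse transition, a form in which smoothness is visible. *)
Let Phi (y' : Z) : Z := row_mx (crd c (par i (lsubmx y')))
  (\row_k pairing (rsubmx y')
     (dif (crd i \o par c) (crd c (par i (lsubmx y'))) (delta_mx ord0 k))).

Let sl : smooth_at (fun y' : Z => lsubmx y') y.
Proof. exact: smooth_at_lsubmx (smooth_at_id _). Qed.

Let st : smooth_at (fun y' : Z => crd c (par i (lsubmx y'))) y.
Proof.
apply: (smooth_at_comp (g := crd c \o par i) sl).
by rewrite yl; exact: (smooth_transition hA).
Qed.

Let smooth_Phi : smooth_at Phi y.
Proof.
apply: smooth_at_row_mx => //; apply/smooth_at_coord => k; under eq_fun do rewrite mxE.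
apply: smooth_pairing; first exact: smooth_at_rsubmx (smooth_at_id _).
apply: smooth_at_dif => //; first exact: smooth_at_cst.
by rewrite yl (crdK hA iz); exact: (smooth_transition hA).
Qed.

Let near_Phi : \forall y' \near y,
  Phi y' = (crd (c : chart (cotangent A)) \o par (i : chart (cotangent A))) y'.
Proof.
have nc : \forall y' \near y, dom c (par i (lsubmx y')).
  have := smooth_at_continuous sl.
  rewrite /prop_for /continuous_at yl => h; exact: (h _ (near_par_overlap hA iz cz)).
apply: filterS2 (near_cotangent iz yl) nc => y' [iy' ey'] cy'.
rewrite /Phi /=; congr row_mx; apply/rowP => k; rewrite !mxE.
rewrite pairing_dual_repr; last first.
  by move=> a u v; rewrite tcrd_linear pairing_linearr.
by rewrite tcrd_tpar.
Qed.

(** Only the base component matters, since the Liouville form sees a tangent vector of the cotangent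
    bundle through its projection to [Q]. *)
Lemma tpar_cotangent u : lsubmx (tpar (i : chart (cotangent A)) y u) =
  dif (crd c \o par i) (crd i z) (lsubmx u).
Proof.
rewrite /tpar -difE.
have -> : chart_at (cotangent A) (par (i : chart (cotangent A)) y) = c.
  by rewrite /= yl (crdK hA iz).
rewrite (near_eq_dif _ near_Phi smooth_Phi).
have lz : linear (lsubmx : Z -> 'rV[R]_N) by move=> a v w; rewrite linearP.
rewrite -(dif_linear_comp u lz smooth_Phi).
rewrite (eq_dif (g := fun y' => (crd c \o par i) (lsubmx y'))); last first.
  by move=> y'; rewrite /Phi row_mxKl.
have s0 : smooth_at (crd c \o par i) (lsubmx y).
  by rewrite yl; exact: (smooth_transition hA).
by rewrite (dif_comp u sl s0) yl (dif_of_linear y u lz).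
Qed.

(** theta = p dq in every chart: the covector and the projected tangent vector both pass through the
    preferred chart at [z], and the two passages cancel. *)
Lemma liouville_tpar u :
  liouville A (par (i : chart (cotangent A)) y) (tpar (i : chart (cotangent A)) y u) =
  pairing p (lsubmx u).
Proof.
rewrite /liouville /=.
set alpha := dual_repr _; set w := tpar _ _ _.
have ez : par i (lsubmx y) = z by rewrite yl (crdK hA iz).
have -> : tmap (cotangent A) A fst (par i (lsubmx y), alpha) w = lsubmx w.
  rewrite /tmap -difE /= ez -/c.
  set y0 := row_mx _ _.
  have yl0 : lsubmx y0 = crd c z by rewrite row_mxKl.
  have H : \forall y' \near y0, lsubmx y' = (crd c \o fst \o par (c : chart (cotangent A))) y'.
    by apply: filterS (near_cotangent cz yl0) => y' [_ /= ->].
  have s0 : smooth_at (fun y' : Z => lsubmx y') y0 by exact: smooth_at_lsubmx (smooth_at_id _).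
  rewrite (near_eq_dif _ H s0) dif_of_linear //.
  by move=> a v v'; rewrite linearP.
rewrite /w tpar_cotangent /alpha pairing_dual_repr; last first.
  by move=> a v v'; rewrite tcrd_linear pairing_linearr.
rewrite ez tcrdE dif_transition // dif_chart_id //.
by rewrite row_mxKr.
Qed.

End Theta.

(** Near the point theta reads p dq, whose value on a constant vector is linear in the coordinates;
    each derivative in [ext_d] is this linear form at the direction. The result is dp ^ dq. *)
Lemma ext_d_liouville (x : Q * 'rV[R]_N) (v w : Z) :
  ext_d (cotangent A) (liouville A) x v w =
  pairing (rsubmx v) (lsubmx w) - pairing (rsubmx w) (lsubmx v).
Proof.
rewrite /ext_d; set i := chart_at _ x.
have ix : dom (i : chart A) x.1 by exact: (chart_atP hA).
set y := crd i x; have yl : lsubmx y = crd (i : chart A) x.1 by rewrite row_mxKl.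
suff D u u' : 'D_u (fun y => liouville A (par i y) (tpar i y u')) y = pairing (rsubmx u) (lsubmx u').
  by rewrite !D.
have H : \forall y' \near y, liouville A (par i y') (tpar i y' u') = pairing (rsubmx y') (lsubmx u').
  apply: filterS (near_cotangent ix yl) => y' [iy' ey'].
  have := liouville_tpar (rsubmx y') iy' u'.
  by rewrite ey' hsubmxK.
rewrite (near_eq_derive _ H).
have l : linear (fun y' : Z => pairing (rsubmx y') (lsubmx u')).
  by move=> a s t; rewrite linearP pairing_linearl.
by rewrite -dif_derive ?dif_of_linear //; exact: smooth_linear.
Qed.

End Cotangent.

(** * The trivialized cotangent bundle of TG *)

Section Symplectic.
Context {R : realType} {n : nat} {G : groupType} {A : atlas R n G}.
Implicit Types V W : normedModType R.
Hypothesis hG : lie_group A.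
Local Notation hA := (lie_manifold hG).
Local Notation Z := 'rV[R]_((n + n) + (n + n)).
Local Notation T := ((G * 'rV[R]_n) * ('rV[R]_n * 'rV[R]_n))%type.
Local Notation rvec := (@rvec R n G A).
Local Notation rinv := (@rinv R n G A).
Local Notation brk := (@brk R n G A).

Lemma TG_manifold : smooth_manifold (TG A).
Proof. by apply: prod_manifold; [exact: hA|exact: vec_manifold]. Qed.

Lemma pairing_adstar xi mu a : pairing (adstar A xi mu) a = - pairing mu (brk xi a).
Proof.
rewrite /adstar (bracket_brk (A := A)) pairing_dual_repr // => k u v.
by rewrite (brk_linearr hG) pairing_linearr /GRing.scale /=; ring.
Qed.

Lemma tmap_mulV g a : tmap A A (fun h => h * g^-1)%g g a = rinv (chart_at A g) g a.
Proof. by rewrite /tmap /rinv difE mulgV. Qed.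

Lemma pairing_TRVstar g mu a :
  pairing (TRVstar A g mu) a = pairing mu (rinv (chart_at A g) g a).
Proof.
rewrite -(pairing_dual_repr (f := fun a => pairing mu (rinv (chart_at A g) g a))).
  by congr (pairing _ _); apply/rowP => k; rewrite !mxE tmap_mulV.
by move=> k u v; rewrite rinv_linear pairing_linearr.
Qed.

Lemma rinv_chart (i j : chart A) g a : dom i g -> dom j g ->
  rinv j g (dif (crd j \o par i) (crd i g) a) = rinv i g a.
Proof.
move=> ig jg; have pj : dom j (par i (crd i g)) by rewrite (crdK hA ig).
have s : smooth_at ((fun w => crd (chart_at A 1%g) (w * g^-1)%g) \o par j) (crd j g).
  apply: (smooth_crd hG (plot_rinv hG jg)).
  by rewrite (crdK hA jg) mulgV; exact: (chart_atP hA).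
have := @dif_plot _ _ _ _ hA _ _ (par i) (crd i g) j (fun w => crd (chart_at A 1%g) (w * g^-1)%g) a (plot_par hA ig) pj.
by rewrite (crdK hA ig) => h; apply: esym; exact: h.
Qed.

Lemma trivK : cancel (triv A) (untriv A).
Proof.
move=> [[g xi] alpha] /=; congr (_, _).
rewrite -[RHS]hsubmxK addrK; congr row_mx; apply: pairing_ext => a.
have cg := chart_atP hA g.
by rewrite pairing_TRVstar pairing_TRstar rinvK.
Qed.

Lemma untrivK : cancel (untriv A) (triv A).
Proof.
move=> [[g xi] [mu nu]] /=; rewrite row_mxKl row_mxKr; congr (_, (_, _)).
rewrite -[RHS](subrK (adstar A xi nu)); congr (_ + _); apply: pairing_ext => a.
have cg := chart_atP hA g.
by rewrite pairing_TRstar pairing_TRVstar rvecK.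
Qed.

(* [triv] and [untriv] read in the canonical coordinates of T^*TG. *)
Definition triv_coord (i : chart A) (y : Z) : Z :=
  row_mx (lsubmx y) (row_mx (mu_coord i y) (rsubmx (rsubmx y))).

Definition untriv_coord (i : chart A) (z : Z) : Z :=
  row_mx (lsubmx z) (row_mx (\row_k
    pairing (lsubmx (rsubmx z) - adstar A (rsubmx (lsubmx z)) (rsubmx (rsubmx z)))
      (rinv i (par i (lsubmx (lsubmx z))) (delta_mx ord0 k))) (rsubmx (rsubmx z))).

Lemma pairing_untriv_coord (i : chart A) (z : Z) a :
  pairing (lsubmx (rsubmx (untriv_coord i z))) a =
  pairing (lsubmx (rsubmx z) - adstar A (rsubmx (lsubmx z)) (rsubmx (rsubmx z)))
    (rinv i (par i (lsubmx (lsubmx z))) a).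
Proof.
rewrite row_mxKr row_mxKl.
set m := _ - _; set g := par i _.
rewrite -(pairing_dual_repr (f := fun a => pairing m (rinv i g a))) //.
by move=> k u v; rewrite rinv_linear pairing_linearr.
Qed.

Lemma untriv_coordK (i : chart A) g z : dom i g -> lsubmx (lsubmx z) = crd i g ->
  triv_coord i (untriv_coord i z) = z.
Proof.
move=> ig zg; rewrite /triv_coord.
have l1 : lsubmx (untriv_coord i z) = lsubmx z by rewrite row_mxKl.
have l2 : rsubmx (rsubmx (untriv_coord i z)) = rsubmx (rsubmx z) by rewrite !row_mxKr.
rewrite l1 l2 -[RHS]hsubmxK -[in RHS](hsubmxK (rsubmx z)); congr (row_mx _ (row_mx _ _)).
apply: pairing_ext => a; rewrite (pairing_mu_coord hG) pairing_untriv_coord l1 l2 zg (crdK hA ig).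
by rewrite rvecK // pairingBl pairing_adstar; ring.
Qed.

Lemma triv_coordK (i : chart A) g y : dom i g -> lsubmx (lsubmx y) = crd i g ->
  untriv_coord i (triv_coord i y) = y.
Proof.
move=> ig yg.
have l1 : lsubmx (triv_coord i y) = lsubmx y by rewrite row_mxKl.
have l2 : rsubmx (rsubmx (triv_coord i y)) = rsubmx (rsubmx y) by rewrite !row_mxKr.
have l3 : lsubmx (rsubmx (triv_coord i y)) = mu_coord i y by rewrite row_mxKr row_mxKl.
rewrite -[LHS]hsubmxK -[in LHS](hsubmxK (rsubmx (untriv_coord i _))).
rewrite -[RHS]hsubmxK -[in RHS](hsubmxK (rsubmx y)); congr (row_mx _ (row_mx _ _)).
- by rewrite row_mxKl.
- apply: pairing_ext => a; rewrite pairing_untriv_coord l3 l1 l2 yg (crdK hA ig).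
  by rewrite pairingBl (pairing_mu_coord hG) pairing_adstar yg (crdK hA ig) rinvK //; ring.
- by rewrite !row_mxKr.
Qed.

Lemma smooth_untriv_coord (i : chart A) g z : dom i g -> lsubmx (lsubmx z) = crd i g ->
  smooth_at (untriv_coord i) z.
Proof.
move=> ig zg; have sid : smooth_at (id : Z -> Z) z by exact: smooth_at_id.
have [sl sr] := (smooth_at_lsubmx sid, smooth_at_rsubmx sid).
apply: smooth_at_row_mx => //; apply: smooth_at_row_mx; last exact: smooth_at_rsubmx.
apply/smooth_at_coord => k; under eq_fun do rewrite mxE.
apply: smooth_pairing.
  apply: smooth_atB; first exact: smooth_at_lsubmx.
  apply/smooth_at_coord => l; under eq_fun do rewrite mxE (bracket_brk (A := A)).
  apply: smooth_atN; apply: smooth_pairing; first exact: smooth_at_rsubmx.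
  by apply: (smooth_brk hG); [exact: smooth_at_rsubmx|exact: smooth_at_cst].
have sq := smooth_at_lsubmx sl.
apply: (smooth_at_rinv hG); last by rewrite zg (crdK hA ig).
  by apply: (plot_comp sq); rewrite zg; exact: (plot_par hA ig).
exact: smooth_at_cst.
Qed.

Lemma smooth_triv_coord (i : chart A) g y : dom i g -> lsubmx (lsubmx y) = crd i g ->
  smooth_at (triv_coord i) y.
Proof.
move=> ig yg; have sid : smooth_at (id : Z -> Z) y by exact: smooth_at_id.
have [sl sr] := (smooth_at_lsubmx sid, smooth_at_rsubmx sid).
apply: smooth_at_row_mx => //; apply: smooth_at_row_mx; last exact: smooth_at_rsubmx.
have := smooth_mu_coord hG (rsubmx (lsubmx y)) (lsubmx (rsubmx y)) (rsubmx (rsubmx y)) ig.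
by rewrite -yg !hsubmxK.
Qed.

Lemma near_q (i : chart A) g (z : Z) : dom i g -> lsubmx (lsubmx z) = crd i g ->
  \forall z' \near z, exists2 g', dom i g' & lsubmx (lsubmx z') = crd i g'.
Proof.
move=> ig zg; apply: filterS (near_row_mx hG ig zg) => z' [g' ig' ->].
by exists g' => //; rewrite !row_mxKl.
Qed.

Lemma dual_repr_row m1 m2 (f : 'rV[R]_(m1 + m2) -> R) :
  dual_repr f = row_mx (\row_k f (row_mx (delta_mx ord0 k) 0))
                       (\row_k f (row_mx 0 (delta_mx ord0 k))).
Proof.
apply/rowP => k; rewrite mxE; case: (split_ordP k) => j ->.
  by rewrite row_mxEl mxE delta_mx_lshift.
by rewrite row_mxEr mxE delta_mx_rshift.
Qed.

Lemma tpar_TG (i : chart A) h xi w : dom i h ->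
  tpar ((i, tt) : chart (TG A)) (row_mx (crd i h) xi) w =
  row_mx (dif (crd (chart_at A h) \o par i) (crd i h) (lsubmx w)) (rsubmx w).
Proof.
move=> ih; rewrite /tpar -difE.
set y0 := row_mx _ _; have yl : lsubmx y0 = crd i h by rewrite row_mxKl.
have -> : chart_at (TG A) (par ((i, tt) : chart (TG A)) y0) = (chart_at A h, tt).
  by rewrite /= yl (crdK hA ih).
have sl : smooth_at (fun y' : 'rV[R]_(n + n) => lsubmx y') y0.
  exact: smooth_at_lsubmx (smooth_at_id _).
have sr : smooth_at (fun y' : 'rV[R]_(n + n) => rsubmx y') y0.
  exact: smooth_at_rsubmx (smooth_at_id _).
have s0 : smooth_at (crd (chart_at A h) \o par i) (lsubmx y0).
  by rewrite yl; apply: (smooth_transition hA ih); exact: (chart_atP hA).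
have s1 : smooth_at (fun y' : 'rV[R]_(n + n) => (crd (chart_at A h) \o par i) (lsubmx y')) y0.
  exact: smooth_at_comp sl s0.
rewrite (eq_dif (g := fun y' : 'rV[R]_(n + n) =>
  row_mx ((crd (chart_at A h) \o par i) (lsubmx y')) (rsubmx y'))); last by [].
rewrite (dif_row_mx _ s1 sr) (dif_comp _ sl s0) yl.
rewrite (dif_of_linear _ _ (l := fun y' : 'rV[R]_(n + n) => lsubmx y')); last by move=> ? ? ?; rewrite linearP.
by rewrite (dif_of_linear _ _ (l := fun y' : 'rV[R]_(n + n) => rsubmx y')) // => ? ? ?; rewrite linearP.
Qed.

(** The covector produced by [untriv] has its components in the preferred chart at [h]; [rinv_chart]
    transports them to [i]. *)
Lemma untriv_coordE (i : chart A) h (z : Z) : dom i h -> lsubmx (lsubmx z) = crd i h ->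
  crd ((i, tt) : chart (TTG A))
    (untriv A (par (((i, tt), (tt, tt)) : chart (TTG_triv A)) z)) = untriv_coord i z.
Proof.
move=> ih zh; rewrite /= zh (crdK hA ih) /untriv_coord zh (crdK hA ih).
congr (row_mx _ _); first by rewrite -zh hsubmxK.
set xi := rsubmx (lsubmx z); set nu := rsubmx (rsubmx z).
set m := lsubmx (rsubmx z) - _.
have ch := chart_atP hA h.
rewrite dual_repr_row; congr (row_mx _ _); apply/rowP => k; rewrite !mxE.
  rewrite tpar_TG // row_mxKl row_mxKr pairing_row pairing0r addr0.
  by rewrite pairing_TRVstar rinv_chart.
rewrite tpar_TG // row_mxKl row_mxKr pairing_row dif0 pairing0r add0r.
by rewrite pairing_delta /nu !mxE.
Qed.

Lemma TTG_triv_manifold : smooth_manifold (TTG_triv A).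
Proof.
apply: prod_manifold; first exact: TG_manifold.
by apply: prod_manifold; exact: vec_manifold.
Qed.

Section AtPoint.
Variable x : T.
Let g := x.1.1.
Let c := chart_at A g.
Let z : Z := crd (chart_at (TTG_triv A) x) x.
Let y := untriv_coord c z.

Let cg : dom c g. Proof. exact: (chart_atP hA). Qed.
Let zE : z = row_mx (row_mx (crd c g) x.1.2) (row_mx x.2.1 x.2.2). Proof. by []. Qed.
Let zg : lsubmx (lsubmx z) = crd c g. Proof. by rewrite zE !row_mxKl. Qed.
Let yg : lsubmx (lsubmx y) = crd c g. Proof. by rewrite /y row_mxKl. Qed.
Let tyz : triv_coord c y = z. Proof. exact: (untriv_coordK cg zg). Qed.

Let dtau := dif (triv_coord c) y.
Let dsigma := dif (untriv_coord c) z.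

Let ss : smooth_at (untriv_coord c) z. Proof. exact: smooth_untriv_coord cg zg. Qed.
Let st : smooth_at (triv_coord c) y. Proof. exact: smooth_triv_coord cg yg. Qed.

Let dsigmaK v : dtau (dsigma v) = v.
Proof.
rewrite /dtau /dsigma -(dif_comp v ss st).
have H : \forall z' \near z, id z' = triv_coord c (untriv_coord c z').
  by apply: filterS (near_q cg zg) => z' [g' ig' e]; rewrite (untriv_coordK ig' e).
by rewrite (near_eq_dif _ H) ?dif_id //; exact: smooth_at_id.
Qed.

Let dtauK v : dsigma (dtau v) = v.
Proof.
have ss' : smooth_at (untriv_coord c) (triv_coord c y) by rewrite tyz.
rewrite /dtau /dsigma -tyz -(dif_comp v st ss').
have H : \forall y' \near y, id y' = untriv_coord c (triv_coord c y').
  by apply: filterS (near_q cg yg) => z' [g' ig' e]; rewrite (triv_coordK ig' e).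
by rewrite (near_eq_dif _ H) ?dif_id //; exact: smooth_at_id.
Qed.

(** Near [z] the coordinate expression of [untriv] is [untriv_coord], so [Omega] is the canonical
    form pulled back by [dsigma]. *)
Let dsigma_tmap v : tmap (TTG_triv A) (TTG A) (untriv A) x v = dsigma v.
Proof.
rewrite /tmap -difE -/z.
have -> : chart_at (TTG A) (untriv A x) = (c, tt).
  by rewrite /c /g; clear; case: x => -[g0 xi0] [mu0 nu0].
have H : \forall z' \near z, untriv_coord c z' =
    (crd ((c, tt) : chart (TTG A)) \o untriv A \o par (chart_at (TTG_triv A) x)) z'.
  by apply: filterS (near_q cg zg) => z' [h ch e]; rewrite /= -(untriv_coordE ch e).
by rewrite (near_eq_dif _ H ss).
Qed.

Let om (a b : Z) : R := pairing (rsubmx a) (lsubmx b) - pairing (rsubmx b) (lsubmx a).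

Let OmegaE v w : Omega A x v w = om (dsigma v) (dsigma w).
Proof.
rewrite /Omega /pullback2 !dsigma_tmap.
exact: (ext_d_liouville TG_manifold).
Qed.

(** dF in canonical coordinates, pulled back by the tangent map of the trivialization. *)
Definition covector (F : T -> R) (b : Z) : R :=
  dif (F \o par (chart_at (TTG_triv A) x)) z (dtau b).

Let covector_linear F : linear (covector F).
Proof. by move=> a u v; rewrite /covector /dtau !dif_linear. Qed.

Let covectorE F b : covector F b =
  pairing (\row_k covector F (row_mx (delta_mx ord0 k) 0)) (lsubmx b) +
  pairing (\row_k covector F (row_mx 0 (delta_mx ord0 k))) (rsubmx b).
Proof.
rewrite -(pairing_dual_repr b (covector_linear F)) dual_repr_row -[in LHS](hsubmxK b).
by rewrite pairing_row.
Qed.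

(** Hamilton's equations: the vector (dF/dp, -dF/dq) of the canonical coordinates, carried to the
    trivialized space by [dtau]. *)
Definition ham (F : T -> R) : Z :=
  dtau (row_mx (\row_k covector F (row_mx 0 (delta_mx ord0 k)))
               (- \row_k covector F (row_mx (delta_mx ord0 k) 0))).

Let mdiffE (F : T -> R) w : mdiff (TTG_triv A) F x w = dif (F \o par (chart_at (TTG_triv A) x)) z w.
Proof. by rewrite difE. Qed.

Lemma ham_hamiltonian F w : Omega A x (ham F) w = - mdiff (TTG_triv A) F x w.
Proof.
rewrite OmegaE mdiffE /ham dtauK /om row_mxKl row_mxKr.
have -> : dif (F \o par (chart_at (TTG_triv A) x)) z w = covector F (dsigma w).
  by rewrite /covector dsigmaK.
by rewrite covectorE (pairingC (- _)) pairingNr opprD (pairingC _ (lsubmx _)) (pairingC _ (rsubmx _)).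
Qed.

(** The canonical form is nondegenerate, as tests on vectors with one zero block show, and [dsigma]
    is bijective. *)
Lemma Omega_inj v v' : (forall w, Omega A x v w = Omega A x v' w) -> v = v'.
Proof.
move=> h; rewrite -(dsigmaK v) -(dsigmaK v'); congr dtau.
have hb b : om (dsigma v) b = om (dsigma v') b by rewrite -(dtauK b) -!OmegaE.
rewrite -[LHS]hsubmxK -[RHS]hsubmxK; congr row_mx; apply: pairing_ext => a.
  have := hb (row_mx 0 a); rewrite /om row_mxKl row_mxKr !pairing0r !sub0r => /oppr_inj.
  by rewrite !(pairingC a).
by have := hb (row_mx a 0); rewrite /om row_mxKl row_mxKr !pairing0l !subr0.
Qed.

Lemma mdiff_ham F K : smooth_at (F \o par (chart_at (TTG_triv A) x)) z ->
  smooth_at (K \o par (chart_at (TTG_triv A) x)) z ->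
  mdiff (TTG_triv A) F x (ham K) =
  canbr (F \o par (chart_at (TTG_triv A) x) \o triv_coord c)
        (K \o par (chart_at (TTG_triv A) x) \o triv_coord c) y.
Proof.
move=> sF sK.
have E F' b : smooth_at (F' \o par (chart_at (TTG_triv A) x)) z ->
    dif (F' \o par (chart_at (TTG_triv A) x) \o triv_coord c) y b = covector F' b.
  move=> s; have s' : smooth_at (F' \o par (chart_at (TTG_triv A) x)) (triv_coord c y) by rewrite tyz.
  by rewrite (dif_comp b st s') tyz.
rewrite mdiffE /ham -/(covector F _) covectorE row_mxKl row_mxKr pairingNr /pairing -sumrB.
by apply: eq_bigr => k _; rewrite !mxE !E // [X in _ - X]mulrC (mulrC (covector F _)).
Qed.

End AtPoint.

Lemma unique_hamiltonian_vf (F : T -> R) :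
  exists! X, hamiltonian_vf (TTG_triv A) (Omega A) F X.
Proof.
exists (fun x => ham x F); split; first by move=> x w; exact: ham_hamiltonian.
move=> X hX; apply/funext => x; apply: (Omega_inj (x := x)) => w.
by rewrite (hX x) ham_hamiltonian.
Qed.

(** The bracket is defined through a choice of Hamiltonian field; by uniqueness the chosen field is
    [ham]. *)
Lemma symplectic_bracketE F K x :
  symplectic_bracket (TTG_triv A) (Omega A) F K x = mdiff (TTG_triv A) F x (ham x K).
Proof.
rewrite /symplectic_bracket; congr (mdiff _ _ _ _).
have [X [hX uX]] := unique_hamiltonian_vf K.
have h1 : hamiltonian_vf (TTG_triv A) (Omega A) K (xget (fun=> 0) [set X | hamiltonian_vf (TTG_triv A) (Omega A) K X]).
  by apply: (@xgetPex _ (fun=> 0) [set X | hamiltonian_vf (TTG_triv A) (Omega A) K X]); exists X.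
apply: (Omega_inj (x := x)) => w; rewrite ham_hamiltonian; exact: h1.
Qed.

(** * The symplectic bracket of functions lifted from the reduced space *)

Lemma smooth_red_proj_loc (H : G * ('rV[R]_n * 'rV[R]_n) -> R) (i : chart A) h (w : Z) :
  smooth_fun (reduced A) H -> dom i h -> lsubmx (lsubmx w) = crd i h ->
  smooth_at (H \o red_proj \o par (((i, tt), (tt, tt)) : chart (TTG_triv A))) w.
Proof.
move=> sH ih wh.
have sid : smooth_at (id : Z -> Z) w by exact: smooth_at_id.
have s1 : smooth_at (fun z : Z => row_mx (lsubmx (lsubmx z)) (rsubmx z)) w.
  by apply: smooth_at_row_mx; [exact: smooth_at_lsubmx (smooth_at_lsubmx sid)|exact: smooth_at_rsubmx].
have s2 : smooth_at (H \o rpar i) (row_mx (lsubmx (lsubmx w)) (rsubmx w)).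
  by rewrite wh; exact: (smooth_rpar hG).
apply: smooth_at_ext (smooth_at_comp s1 s2).
by near=> z; rewrite /= /rpar /red_proj /= row_mxKl row_mxKr.
Unshelve. all: by end_near. Qed.

Lemma symplectic_bracket_reduced H K :
  smooth_fun (reduced A) H -> smooth_fun (reduced A) K ->
  symplectic_bracket (TTG_triv A) (Omega A) (H \o red_proj) (K \o red_proj)
     = red_bracket A H K \o red_proj.
Proof.
move=> sH sK; apply/funext => x; rewrite symplectic_bracketE.
have cg := chart_atP hA x.1.1.
set c := chart_at A x.1.1; set z := crd (chart_at (TTG_triv A) x) x.
have zg : lsubmx (lsubmx z) = crd c x.1.1 by rewrite !row_mxKl.
have sF F : smooth_fun (reduced A) F -> smooth_at (F \o red_proj \o par (chart_at (TTG_triv A) x)) z.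
  by move=> s; exact: (smooth_red_proj_loc s cg zg).
rewrite (mdiff_ham (sF _ sH) (sF _ sK)) -/c -/z.
(* In canonical coordinates a lifted function factors through [red_coord], the case treated by
   [canbr_red]. *)
have lE F : F \o red_proj \o par (chart_at (TTG_triv A) x) \o triv_coord c = F \o rpar c \o red_coord c.
  apply/funext => y; rewrite /= /rpar /red_coord /red_proj /triv_coord /=.
  by rewrite !row_mxKl !row_mxKr !row_mxKl.
rewrite !lE.
have yg : lsubmx (lsubmx (untriv_coord c z)) = crd c x.1.1 by rewrite row_mxKl.
have tz := untriv_coordK cg zg.
have := canbr_red hG (rsubmx (lsubmx (untriv_coord c z))) (lsubmx (rsubmx (untriv_coord c z))) (rsubmx (rsubmx (untriv_coord c z))) cg sH sK.
rewrite -/c -yg !hsubmxK => ->; congr (red_bracket A H K _).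
have -> : red_coord c (untriv_coord c z) = row_mx (lsubmx (lsubmx (triv_coord c (untriv_coord c z)))) (rsubmx (triv_coord c (untriv_coord c z))).
  by rewrite /red_coord /triv_coord row_mxKl row_mxKr.
rewrite tz zg -[rsubmx z]hsubmxK rparE (crdK hA cg) /z !row_mxKr !row_mxKl.
by rewrite /red_proj; case: (x.2).
Qed.

End Symplectic.

(** * The action of the Lie algebra *)

Section Action.
Context {R : realType} {n : nat} {G : groupType} {A : atlas R n G}.
Hypothesis hG : lie_group A.
Local Notation hA := (lie_manifold hG).
Local Notation Z := 'rV[R]_((n + n) + (n + n)).
Local Notation T := ((G * 'rV[R]_n) * ('rV[R]_n * 'rV[R]_n))%type.

Lemma tg_coAd0 x : tg_coAd A x (row_mx 0 0) = 0.
Proof. by apply/rowP => k; rewrite !mxE row_mx0 pairing0l. Qed.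

Lemma Ad0 g : Ad A g 0 = 0.
Proof. by rewrite AdE; exact: dif0. Qed.

Lemma AdD g a b : Ad A g (a + b) = Ad A g a + Ad A g b.
Proof. by rewrite !AdE; exact: (linearD (dif _ _)). Qed.

Lemma g_incl_morph (xi zeta : 'rV[R]_n) :
  g_incl (xi + zeta) = ttg_mul A (g_incl xi) (g_incl zeta) :> T.
Proof.
rewrite /ttg_mul /g_incl /tg_mul /= tg_coAd0 mulg1 AdE (adj1 hG).
by rewrite linear0 [rsubmx _]linear0 !addr0.
Qed.

Lemma g_act_mulr (p : T) xi : g_act A p xi = ttg_mul A p (g_incl xi).
Proof.
case: p => [[h eta] [mu nu]]; rewrite /ttg_mul /g_incl /tg_mul /= tg_coAd0 mulg1.
by rewrite linear0 [rsubmx _]linear0 !addr0.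
Qed.

Lemma g_act0 (p : T) : g_act A p 0 = p.
Proof. by case: p => [[h eta] [mu nu]]; rewrite /g_act Ad0 addr0. Qed.

Lemma g_actD (p : T) xi zeta : g_act A p (xi + zeta) = g_act A (g_act A p xi) zeta.
Proof. by case: p => [[h eta] [mu nu]]; rewrite /g_act AdD addrA. Qed.

(** The action adds Ad_h xi, so a prescribed translation of the fibre is solved for xi by Ad of the
    inverse of [h]. *)
Lemma g_act_fiber (h : G) (eta : 'rV[R]_n) m eta' :
  ((h, eta'), m) = g_act A ((h, eta), m) (Ad A h^-1%g (eta' - eta)).
Proof.
case: m => mu nu; rewrite /g_act !AdE (adjKV hG).
by rewrite addrC subrK.
Qed.

Lemma red_proj_fibers (p q : T) : red_proj p = red_proj q <->
  exists xi : 'rV[R]_n, q = g_act A p xi.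
Proof.
split; last by move: p => [[h eta] [mu nu]] [xi ->].
move: p q => [[h eta] m] [[h' eta'] m'] [/= -> ->].
by exists (Ad A h'^-1%g (eta' - eta)); exact: g_act_fiber.
Qed.

Lemma invariant_functions (F : T -> R) :
  (smooth_fun (TTG_triv A) F /\ forall p (xi : 'rV[R]_n), F (g_act A p xi) = F p) <->
  exists2 H, smooth_fun (reduced A) H & F = H \o red_proj.
Proof.
have hT := TTG_triv_manifold hG; have hR := reduced_manifold hG.
split=> [[/(smooth_funP hT) sF inv]|[H sH ->]]; last first.
  split; last by move=> [[h eta] [mu nu]] xi.
  apply/(smooth_funP hT) => -[[i []] [[] []]] [[h eta] [mu nu]] [[/= ih _] _].
  by apply: (smooth_red_proj_loc hG sH ih); rewrite !row_mxKl.
(* [F] is restricted to the section xi = 0, which meets each orbit exactly once. *)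
exists (fun r => F ((r.1, 0), r.2)).
  apply/(smooth_funP hR) => -[i [[] []]] [h [mu nu]] [/= ih _].
  set w : 'rV[R]_(n + (n + n)) := row_mx _ _.
  have sid : smooth_at (id : 'rV[R]_(n + (n + n)) -> _) w by exact: smooth_at_id.
  have s1 : smooth_at (fun y : 'rV[R]_(n + (n + n)) => row_mx (row_mx (lsubmx y) 0) (rsubmx y) : Z) w.
    apply: smooth_at_row_mx; last exact: smooth_at_rsubmx.
    by apply: smooth_at_row_mx; [exact: smooth_at_lsubmx|exact: smooth_at_cst].
  have s2 := sF (((i, tt), (tt, tt)) : chart (TTG_triv A)) ((h, 0), (mu, nu)) (conj (conj ih I) (conj I I)).
  have e : row_mx (row_mx (lsubmx w) 0) (rsubmx w) =
      crd (((i, tt), (tt, tt)) : chart (TTG_triv A)) ((h, 0), (mu, nu)).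
    by rewrite /w row_mxKl row_mxKr.
  rewrite -e in s2; apply: smooth_at_ext (smooth_at_comp s1 s2).
  by near=> y; rewrite /= !row_mxKl !row_mxKr.
apply/funext => -[[h eta] m] /=.
by rewrite (g_act_fiber h eta m 0) inv.
Unshelve. all: by end_near. Qed.

End Action.

Theorem proposition4p8 (R : realType) (n : nat) (G : groupType)
    (A : atlas R n G) (hG : lie_group A) :
  (* the Lie bracket is d/dt Ad_(exp (t xi)) eta at t = 0 *)
  (forall (xi eta : 'rV[R]_n) (gam : R -> G),
     one_parameter_subgroup A xi gam ->
     is_derive (0 : R) (1 : R) (fun t => Ad A (gam t) eta)
       (bracket A xi eta)) /\
  (* T^*TG is identified with the trivialized space, where every
     function has exactly one Hamiltonian vector field *)
  (cancel (triv A) (untriv A) /\ cancel (untriv A) (triv A)) /\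
  (forall F, smooth_fun (TTG_triv A) F ->
     exists! X, hamiltonian_vf (TTG_triv A) (Omega A) F X) /\
  (* g is an abelian subgroup of the trivialized T^*TG; it acts by right
     translations *)
  (forall xi zeta : 'rV[R]_n,
     g_incl (xi + zeta) = ttg_mul A (g_incl xi) (g_incl zeta) :> _ * _) /\
  (forall p (xi : 'rV[R]_n), g_act A p xi = ttg_mul A p (g_incl xi)) /\
  (forall p, g_act A p 0 = p) /\
  (forall p (xi zeta : 'rV[R]_n),
     g_act A p (xi + zeta) = g_act A (g_act A p xi) zeta) /\
  (* the quotient of T^*TG by g is the reduced manifold *)
  (forall p q, red_proj p = red_proj q <->
     exists xi : 'rV[R]_n, q = g_act A p xi) /\
  (forall F, (smooth_fun (TTG_triv A) F /\
              forall p (xi : 'rV[R]_n), F (g_act A p xi) = F p) <->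
     exists2 H, smooth_fun (reduced A) H & F = H \o red_proj) /\
  (* the bracket of invariant functions *)
  (forall H K, smooth_fun (reduced A) H -> smooth_fun (reduced A) K ->
     symplectic_bracket (TTG_triv A) (Omega A) (H \o red_proj) (K \o red_proj)
     = red_bracket A H K \o red_proj) /\
  poisson_manifold (reduced A) (red_bracket A).
Proof.
split; first exact: (bracket_one_parameter hG).
split; first by split; [exact: (trivK hG)|exact: (untrivK hG)].
split; first by move=> F _; exact: (unique_hamiltonian_vf hG).
split; first exact: (g_incl_morph hG).
split; first exact: g_act_mulr.
split; first exact: g_act0.
split; first exact: g_actD.
split; first exact: (red_proj_fibers hG).
split; first exact: (invariant_functions hG).
split; first exact: (symplectic_bracket_reduced hG).
exact: (red_bracket_poisson hG).
Qed.
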